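(* Let $K$ be a field, let $p_1,\dots,p_n\in\mathbf{P}^2$ be distinct points ($n\ge 1$), and let $I=\bigcap_i I(p_i)\subset R=K[\mathbf{P}^2]=K[x_0,x_1,x_2]$. For $m\geq 1$ set $\alpha_m=\alpha(I^{(m)})$ and $\beta_m=\beta(I^{(m)})$. Then for every $m\ge 1$: (i) $\alpha_m\beta_m\ge m^2n$, and (ii) $\displaystyle\frac{\alpha_m}{m}\ge\Big(\frac{\alpha_1+1}{2}\Big)\Big(\frac{m\alpha_1}{\beta_m}\Big)$. Moreover, if $\alpha_m\beta_m=m^2n$, then $(I^{(m)})^k=I^{(mk)}$ for all $k\ge 1$.
   Context: For a point $p\in\mathbf{P}^2$ (a $K$-rational point), $I(p)\subset R$ is the ideal generated by all forms vanishing at $p$. For $I=\bigcap_i I(p_i)$ with distinct $p_i$, the $m$-th symbolic power is $I^{(m)}=\bigcap_i I(p_i)^m$. For a homogeneous ideal $J$, with degree-$l$ component $J_l$: $\alpha(J)$ is the smallest integer $l$ such that $J_l\ne 0$, and $\beta(J)$ is the smallest integer $l$ such that $J_l$ contains a regular sequence of length two. *)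

(* Defs.v *)
From HB Require Import structures.
From mathcomp Require Import all_boot all_order all_algebra.
From mathcomp Require Import mpoly.
From Stdlib Require Import ClassicalEpsilon.

Set Implicit Arguments.
Unset Strict Implicit.
Unset Printing Implicit Defensive.

Import GRing.Theory.
Local Open Scope ring_scope.

(* Ideals are Prop-valued predicates on the ring; equality of ideals is stated
   extensionally. *)
Section Ideals.
Variable A : comNzRingType.
Implicit Types (S J : A -> Prop).

Definition ideal_gen S : A -> Prop := fun f =>
  exists s : seq (A * A),
    (forall x, x \in s -> S x.2) /\ f = \sum_(x <- s) x.1 * x.2.

Definition ideal_mul J1 J2 : A -> Prop :=
  ideal_gen (fun h => exists f g, [/\ J1 f, J2 g & h = f * g]).

Definition ideal_pow J (k : nat) : A -> Prop :=
  iter k (ideal_mul J) (fun=> True).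

(* Each s_i is a nonzerodivisor modulo (s_0, ..., s_{i-1}), and the quotient of
   A by the whole sequence is nonzero. *)
Definition regular_sequence (s : seq A) : Prop :=
  (forall i, (i < size s)%N -> forall h : A,
     ideal_gen (fun f => f \in take i s) (s`_i * h) ->
     ideal_gen (fun f => f \in take i s) h)
  /\ ~ ideal_gen (fun f => f \in s) 1.

End Ideals.

Definition is_least (P : nat -> Prop) (l : nat) : Prop :=
  P l /\ forall k, P k -> (l <= k)%N.

(* Unspecified when P holds nowhere. *)
Definition least (P : nat -> Prop) : nat := epsilon (inhabits 0%N) (is_least P).

Lemma leastP (P : nat -> Prop) : (exists l, P l) -> is_least P (least P).
Proof.
case=> l Pl; apply: epsilon_spec.
elim/ltn_ind: l Pl => l IHl Pl.
case: (classic (exists2 k, (k < l)%N & P k)) => [[k lt_kl Pk]|noP].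
  exact: IHl lt_kl Pk.
exists l; split=> // k Pk; rewrite leqNgt; apply/negP => lt_kl.
by apply: noP; exists k.
Qed.

Section ProjectivePlane.
Variable K : fieldType.
Implicit Types (J : {mpoly K[3]} -> Prop).

(* A point of the projective plane is given by a nonzero vector of homogeneous
   coordinates; two such vectors give the same point iff same_point holds. *)
Definition same_point (u v : 'rV[K]_3) : Prop :=
  exists2 c : K, c != 0 & v = c *: u.

Definition component J (l : nat) : {mpoly K[3]} -> Prop :=
  fun f => J f /\ f \is l.-homog.

Definition point_ideal (u : 'rV[K]_3) : {mpoly K[3]} -> Prop :=
  ideal_gen (fun f => (exists d, f \is d.-homog) /\ f.@[u 0] = 0).

(* I^(m) for I the intersection of the point_ideal (p i). *)
Definition symbolic_power n (p : 'I_n -> 'rV[K]_3) (m : nat) :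
    {mpoly K[3]} -> Prop :=
  fun f => forall i, ideal_pow (point_ideal (p i)) m f.

Definition alpha J : nat :=
  least (fun l => exists2 f, component J l f & f != 0).

Definition beta J : nat :=
  least (fun l => exists f g,
    [/\ component J l f, component J l g & regular_sequence [:: f; g]]).

End ProjectivePlane.

(* Main.v *)
Require Import Defs.
From HB Require Import structures.
From mathcomp Require Import all_boot all_order all_algebra.
From mathcomp Require Import mpoly.
From mathcomp Require Import ring zify.

Set Implicit Arguments.
Unset Strict Implicit.
Unset Printing Implicit Defensive.

Import GRing.Theory Num.Theory.
Local Open Scope ring_scope.

(* Write I(r) for the forms vanishing to order at least r at every p_i. In degree
   t, I(r) has codimension at most n r(r+1)/2, with equality for t large.

   Let F, G be coprime forms of degrees a, b in I(m). In large degree t, the space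
   F I(s)_(t-a) + G I(s)_(t-b), with s >= m, lies in I(s+m)_t, and the two
   summands meet in the multiples wFG, for the forms w with wF and wG in I(s).
   For s = m every w is allowed, and counting dimensions gives ab >= n m^2. Together
   with n >= alpha_1(alpha_1+1)/2, i.e. no form of degree alpha_1 - 1 vanishes at
   all the points, this yields (ii).

   If ab = n m^2, the count is sharp for s = m: I(2m) = F I(m) + G I(m) in large
   degree. As I(2m) has members of order exactly 2m at each p_i, a form w with wF
   and wG in I(s) lies in I(s-m), so the count is sharp for every multiple s of m
   and I(m(k+1)) agrees with (F,G)^k I(m) in large degree. The latter ideal is
   saturated since R/(F,G) and R/I(m) have positive depth and (F,G)^k/(F,G)^(k+1)
   is free over R/(F,G); hence I(m(k+1)) = (F,G)^k I(m), which is contained in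
   I(m)^(k+1).

   A form F of degree alpha_m and a regular sequence g1, g2 in degree beta_m provide
   such a pair over K(t), namely F and g1 + t g2; since I(m) over K(t) is spanned
   by I(m) over K, the conclusion descends by comparing coefficients of powers of t.
   That beta_m exists, also over finite fields, is witnessed by a product of lines
   and a product of smooth conics. *)

(** * Monomials in three variables *)

Local Notation i0 := (@Ordinal 3 0 isT).
Local Notation i1 := (@Ordinal 3 1 isT).
Local Notation i2 := (@Ordinal 3 2 isT).

Lemma ord3P (P : 'I_3 -> Prop) : P i0 -> P i1 -> P i2 -> forall j, P j.
Proof.
move=> P0 P1 P2 [[|[|[|//]]] h].
- by rewrite (_ : Ordinal h = i0) //; apply: val_inj.
- by rewrite (_ : Ordinal h = i1) //; apply: val_inj.
- by rewrite (_ : Ordinal h = i2) //; apply: val_inj.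
Qed.

Lemma big_ord3 (T : Type) (idx : T) (op : Monoid.law idx) (F : 'I_3 -> T) :
  \big[op/idx]_(i < 3) F i = op (F i0) (op (F i1) (F i2)).
Proof.
rewrite !big_ord_recl big_ord0 Monoid.mulm1.
by congr (op (F _) (op (F _) (F _))); apply: val_inj.
Qed.

Lemma mdeg3 (m : 'X_{1..3}) : mdeg m = (m i0 + (m i1 + m i2))%N.
Proof. by rewrite mdegE big_ord3. Qed.

Definition mnm3 (a b c : nat) : 'X_{1..3} :=
  [multinom nth 0%N [:: a; b; c] i | i < 3].

Lemma mnm3E a b c :
  [/\ mnm3 a b c i0 = a, mnm3 a b c i1 = b & mnm3 a b c i2 = c].
Proof.
by rewrite !mnmE.
Qed.

Lemma mnm3_eq (m : 'X_{1..3}) : m = mnm3 (m i0) (m i1) (m i2).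
Proof.
by apply/mnmP; have [e0 e1 e2] := mnm3E (m i0) (m i1) (m i2); apply: ord3P.
Qed.

Lemma mdeg_mnm3 a b c : mdeg (mnm3 a b c) = (a + (b + c))%N.
Proof. by rewrite mdeg3; have [-> -> ->] := mnm3E a b c. Qed.

(** * Linear changes of coordinates and vanishing orders *)

Section Change.
Variable K : fieldType.
Implicit Types (A B : 'M[K]_3) (f g h : {mpoly K[3]}).

(** Column [j] of [A] gives the image of ['X_j], so the value at the [i]-th unit vector becomes the
    value of [f] at row [i] of [A]. *)
Definition chg A f : {mpoly K[3]} :=
  f \mPo [tuple \sum_i A i j *: 'X_i | j < 3].

HB.instance Definition _ A :=
  GRing.isZmodMorphism.Build {mpoly K[3]} {mpoly K[3]} (chg A)
    (raddfB (comp_mpoly [tuple \sum_i A i j *: 'X_i | j < 3])).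
HB.instance Definition _ A :=
  GRing.isMonoidMorphism.Build {mpoly K[3]} {mpoly K[3]} (chg A)
    (rmorphism_monoidP (comp_mpoly [tuple \sum_i A i j *: 'X_i | j < 3])).
HB.instance Definition _ A :=
  GRing.isScalable.Build K {mpoly K[3]} {mpoly K[3]} _ (chg A)
    (linearZ_LR (comp_mpoly [tuple \sum_i A i j *: 'X_i | j < 3])).

#[global] Arguments chg : simpl never.

Lemma chgX A j : chg A 'X_j = \sum_i A i j *: 'X_i.
Proof. by rewrite /chg comp_mpolyXU -tnth_nth tnth_mktuple. Qed.

Lemma chg_eval A f v : (chg A f).@[v] = f.@[fun j => \sum_i A i j * v i].
Proof.
rewrite /chg comp_mpoly_meval; apply: meval_eq => j.
by rewrite tnth_mktuple raddf_sum; apply: eq_bigr => i _; rewrite /= mevalZ mevalXU.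
Qed.

Lemma mpoly_rmorph_eq (n : nat) (S : comNzRingType)
    (phi psi : {rmorphism {mpoly K[n]} -> S}) :
  (forall c, phi c%:MP = psi c%:MP) -> (forall i, phi 'X_i = psi 'X_i) ->
  phi =1 psi.
Proof.
move=> eqC eqX; elim/mpolyind => [|c m p _ _ IH]; first by rewrite !rmorph0.
rewrite !rmorphD IH -mul_mpolyC !rmorphM /= eqC; congr (_ * _ + _).
rewrite mpolyXE_id !rmorph_prod; apply: eq_bigr => i _.
by rewrite !rmorphXn /= eqX.
Qed.

Lemma chgC A c : chg A c%:MP = c%:MP.
Proof. exact: comp_mpolyC. Qed.

Lemma chg_comp A B f : chg B (chg A f) = chg (B *m A) f.
Proof.
apply: (mpoly_rmorph_eq (phi := chg B \o chg A)) => [c|j] /=; first by rewrite !chgC.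
rewrite !chgX raddf_sum /=.
under eq_bigr => i _ do rewrite linearZ /= chgX scaler_sumr.
rewrite exchange_big; apply: eq_bigr => k _ /=.
rewrite mxE scaler_suml; apply: eq_bigr => i _.
by rewrite scalerA mulrC.
Qed.

Lemma chg1 f : chg 1%:M f = f.
Proof.
apply: (mpoly_rmorph_eq (phi := chg _) (psi := idfun)) => [c|j] /=; first by rewrite !chgC.
rewrite chgX (bigD1 j) //= mxE eqxx scale1r big1 ?addr0 // => i /negbTE nij.
by rewrite mxE nij scale0r.
Qed.

Lemma chgK A : A \in unitmx -> cancel (chg A) (chg (invmx A)).
Proof. by move=> uA f; rewrite chg_comp mulVmx // chg1. Qed.

Lemma chgVK A : A \in unitmx -> cancel (chg (invmx A)) (chg A).
Proof. by move=> uA f; rewrite chg_comp mulmxV // chg1. Qed.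

Lemma dhomogXU j : ('X_j : {mpoly K[3]}) \is 1.-homog.
Proof. by rewrite dhomogX; apply/eqP; exact: mdeg1. Qed.

Lemma dhomog_chg A d f : f \is d.-homog -> chg A f \is d.-homog.
Proof.
move=> /dhomogP hf; rewrite [f]mpolyE raddf_sum /= big_seq.
apply: rpred_sum => m /hf <-; rewrite linearZ /= rpredZ //.
rewrite mpolyXE_id rmorph_prod /= mdegE.
elim/big_rec2: _ => [|i e q _ hq]; first exact: dhomog1.
apply: dhomogM => //; rewrite rmorphXn /=.
have := @dhomogMn 3 K mdeg 1 (chg A 'X_i) (m i); rewrite mul1n; apply.
by rewrite chgX; apply: rpred_sum => k _; rewrite rpredZ ?dhomogXU.
Qed.

Lemma pihomog_chg A d f : pihomog mdeg d (chg A f) = chg A (pihomog mdeg d f).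
Proof.
have [k lek] := ex_intro (fun k => msize f <= k)%N _ (leqnn _).
rewrite [in LHS](pihomog_partitionE lek) (raddf_sum (chg A)) (raddf_sum (pihomog mdeg d)) /=.
have hom e : chg A (pihomog mdeg e f) \is e.-homog by apply/dhomog_chg/pihomogP.
case: (ltnP d k) => [ltd|led].
  rewrite (bigD1 (Ordinal ltd)) //= (pihomog_dE (hom d)) big1 ?addr0 // => e ne.
  by rewrite (pihomog_ne0 _ (hom e)).
rewrite big1 => [|e _]; last first.
  by rewrite (pihomog_ne0 _ (hom e)) // neq_ltn (leq_trans (ltn_ord e) led).
suff -> : pihomog mdeg d f = 0 by rewrite raddf0.
rewrite pihomogE big1_seq // => m /andP[/eqP dm /msize_mdeg_lt].
by rewrite dm ltnNge (leq_trans lek led).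
Qed.

(* At the point [row 0 A], [chg A] provides the coordinates X0 (a unit there)
   and X1, X2 (local parameters): [van A r f] is vanishing to order [r]. *)
Definition ord_ge r f := forall m : 'X_{1..3}, (m i1 + m i2 < r)%N -> f@_m = 0.

Definition van A r f := ord_ge r (chg A f).

Lemma van0 A f : van A 0 f. Proof. by []. Qed.

Lemma van_mono A r s f : (s <= r)%N -> van A r f -> van A s f.
Proof. by move=> le_sr vf m lt_ms; apply: vf; apply: leq_trans le_sr. Qed.

Lemma van_zero A r : van A r 0.
Proof. by move=> m _; rewrite rmorph0 mcoeff0. Qed.

Lemma vanD A r f g : van A r f -> van A r g -> van A r (f + g).
Proof. by move=> vf vg m lt_m; rewrite rmorphD mcoeffD vf ?vg ?addr0. Qed.

Lemma ord_geM r s f g : ord_ge r f -> ord_ge s g -> ord_ge (r + s) (f * g).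
Proof.
move=> vf vg m lt_m.
rewrite (mcoeffM f g m) big1 // => -[u v] /= /eqP def_m.
have [lt_u|le_u] := ltnP (u i1 + u i2) r; first by rewrite vf ?mul0r.
have [lt_v|le_v] := ltnP (v i1 + v i2) s; first by rewrite vg ?mulr0.
have := (congr1 (fun M : 'X_{1..3} => M i1) def_m, congr1 (fun M : 'X_{1..3} => M i2) def_m).
by rewrite !mnmDE => -[]; lia.
Qed.

Lemma vanM A r s f g : van A r f -> van A s g -> van A (r + s) (f * g).
Proof. by move=> vf vg; rewrite /van rmorphM; apply: ord_geM. Qed.

Lemma vanMl A r f g : van A r g -> van A r (f * g).
Proof. exact: (@vanM A 0). Qed.

Lemma vanX A r k f : van A r f -> van A (r * k) (f ^+ k).
Proof.
move=> vf; elim: k => [|k IH]; first by rewrite muln0.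
by rewrite mulnS exprS; apply: vanM.
Qed.

Lemma van_pihomog A r d f : van A r f -> van A r (pihomog mdeg d f).
Proof.
move=> vf m lt_m; rewrite -pihomog_chg.
case: (eqVneq (mdeg m) d) => [dm|ne_m]; last first.
  by rewrite (dhomog_nemf_coeff _ ne_m) // pihomogP.
rewrite pihomogE raddf_sum /= big1_seq // => k /andP[_ _].
rewrite mcoeffZ mcoeffX; case: eqVneq => [->|_]; last by rewrite mulr0.
by rewrite vf ?mul0r.
Qed.

Lemma coef_dhomog0 d f : f \is d.-homog ->
  f@_(mnm3 d 0 0) = f.@[fun j => (j == i0)%:R].
Proof.
move=> /dhomogP hf; rewrite [in RHS](mpolyE f) raddf_sum /= [in LHS](mpolyE f) raddf_sum /=.
apply: eq_big_seq => m /hf hm; have dm : mdeg m = d := hm.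
rewrite mcoeffZ mevalZ mcoeffX mevalX big_ord3 /= expr1n mul1r.
congr (_ * _); move: dm; rewrite mdeg3 => dm; rewrite !expr0n.
have [e0 e1 e2] := mnm3E d 0 0.
case: eqVneq => [->|/eqP ne]; first by rewrite e1 e2 mulr1.
case: eqP => [m1|_]; last by rewrite mul0r.
case: eqP => [m2|_]; last by rewrite mulr0.
by case: ne; rewrite [m]mnm3_eq m1 m2; congr mnm3; move: dm; rewrite m1 m2 !addn0.
Qed.

Lemma eval_chg0 A f : f.@[A i0] = (chg A f).@[fun j => (j == i0)%:R].
Proof.
by rewrite chg_eval; apply: meval_eq => j; rewrite big_ord3 /= mulr1 !mulr0 !addr0.
Qed.

Lemma coef_chg0 A d f : f \is d.-homog ->
  (chg A f)@_(mnm3 d 0 0) = f.@[A i0].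
Proof.
move=> hf; by rewrite (@coef_dhomog0 d) ?dhomog_chg // -eval_chg0.
Qed.

Lemma van1 A d f : f \is d.-homog -> f.@[A i0] = 0 -> van A 1 f.
Proof.
move=> hf f0 m lt_m; have cf := dhomog_chg A hf.
case: (eqVneq (mdeg m) d) => [dm|]; last exact: dhomog_nemf_coeff.
have [m1 m2] : m i1 = 0%N /\ m i2 = 0%N by lia.
have m0 : m i0 = d by move: dm; rewrite mdeg3 m1 m2 !addn0.
by rewrite [m]mnm3_eq m0 m1 m2 coef_chg0.
Qed.

Lemma van_eval A r f : (0 < r)%N -> van A r f -> f.@[A i0] = 0.
Proof.
move=> r_gt0 vf; rewrite eval_chg0 [chg A f]mpolyE raddf_sum /= big1_seq // => m _.
rewrite mevalZ mevalX big_ord3 /= !expr0n.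
case: (eqVneq (m i1) 0%N) => m1; last by rewrite mul0r mulr0 mulr0.
case: (eqVneq (m i2) 0%N) => m2; last by rewrite !mulr0.
by rewrite vf ?mul0r // m1 m2.
Qed.

(** A form nonzero at the point is a unit in its local ring. By induction on the local degree of
    [m], the coefficient of X0^d times [m] in [chg A (h * f)] reduces to the value of [h] times the
    coefficient of [m] in [chg A f]. *)
Lemma van_cancel A r d h f : h \is d.-homog -> h.@[A i0] != 0 ->
  van A r (h * f) -> van A r f.
Proof.
move=> hom_h h0 vhf m; move e: (m i1 + m i2)%N => k lt_kr.
elim/ltn_ind: k m e lt_kr => k IH m e lt_kr.
have := vhf (mnm3 d 0 0 + m)%MM.
rewrite !mnmDE; have [e0 e1 e2] := mnm3E d 0 0; rewrite e1 e2 e => /(_ lt_kr).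
rewrite rmorphM mcoeffM.
set M := (mnm3 d 0 0 + m)%MM.
have lt1 : (mdeg (mnm3 d 0 0) < (mdeg M).+1)%N by rewrite mdegD ltnS leq_addr.
have lt2 : (mdeg m < (mdeg M).+1)%N by rewrite mdegD ltnS leq_addl.
rewrite (bigD1 (BMultinom lt1, BMultinom lt2)) //= big1 ?addr0 => [|[u v] /= /andP[/eqP def_M ne]].
  by rewrite coef_chg0 // => /eqP; rewrite mulf_eq0 (negbTE h0) => /eqP.
have [le_v|lt_v] := leqP k (v i1 + v i2); last by rewrite [X in _ * X](IH _ lt_v) ?mulr0 //; lia.
have defM j : M j = (u j + v j)%N by move: (congr1 (fun N : 'X_{1..3} => N j) def_M); rewrite mnmDE.
have [u1 u2] : u i1 = 0%N /\ u i2 = 0%N.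
  have := (defM i1, defM i2); rewrite /M !mnmDE e1 e2 => -[]; move: e le_v.
  by move: (m i1) (m i2) (u i1) (u i2) (v i1) (v i2) => ? ? ? ? ? ?; lia.
case: (eqVneq (mdeg u) d) => [du|nu]; last first.
  by rewrite (dhomog_nemf_coeff _ nu) ?mul0r // dhomog_chg.
have def_u : val u = mnm3 d 0 0.
  have u0 : u i0 = d by move: du; rewrite mdeg3 u1 u2 !addn0.
  by rewrite [val u]mnm3_eq u0 u1 u2.
case/eqP: ne; congr pair; apply: val_inj => //=.
by apply/mnmP=> j; have := defM j; rewrite -[bmnm u]/(val u) def_u /M mnmDE => /addnI.
Qed.

Lemma van_X1 A r f : A \in unitmx -> van A r.+1 (chg (invmx A) 'X_i1 * f) -> van A r f.
Proof.
move=> uA vf m lt_m; have := vf (m + U_(i1))%MM.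
rewrite (rmorphM (chg A)) /= chgVK // mulrC addmC mcoeffMX; apply.
by rewrite !mnmDE !mnm1E /=; lia.
Qed.

Lemma van_X1n A r k f : A \in unitmx ->
  van A (r + k) (chg (invmx A) 'X_i1 ^+ k * f) -> van A r f.
Proof.
move=> uA; elim: k => [|k IH]; first by rewrite addn0 mul1r.
by rewrite addnS exprS -mulrA => /(van_X1 uA).
Qed.

End Change.

(** * Hilbert functions of fat points *)

Section Jets.
Variables (K : fieldType) (n : nat) (A : 'I_n -> 'M[K]_3).
Hypothesis uA : forall i, A i \in unitmx.
Implicit Types f g h : {mpoly K[3]}.

Definition vanish r f := forall i, van (A i) r f.

(* The pair (e, b), with b <= e < r, stands for the local monomial X1^(e-b) X2^b. *)
Definition jetidx r := {e : 'I_r & 'I_e.+1}.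

Lemma card_jetidx r : #|{: jetidx r}| = 'C(r.+1, 2).
Proof.
rewrite card_tagged sumnE big_map big_enum /=.
under eq_bigr => e _ do rewrite card_ord.
by rewrite -(big_mkord xpredT S) -bin2_sum big_nat_recl //= add0n.
Qed.

Lemma jetidx_eq r (x y : jetidx r) :
  tag x = tag y :> nat -> tagged x = tagged y :> nat -> x = y.
Proof.
case: x y => ex bx [ey by_] /= /val_inj e; case: _ / e by_ => by_ eb.
by congr (Tagged _ _); apply: val_inj.
Qed.

(** The local monomial made homogeneous of degree [t] by a power of X0. If [tag x] exceeds [t],
    truncated subtraction leaves a monomial of degree other than [t], whose coefficient in a form of
    degree [t] is zero. *)
Definition jetmon r t (x : jetidx r) :=
  mnm3 (t - tag x) (tag x - tagged x) (tagged x).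

Lemma jetmon_sum r t (x : jetidx r) :
  (jetmon t x i1 + jetmon t x i2 = tag x)%N.
Proof.
rewrite /jetmon; have [_ -> ->] := mnm3E (t - tag x) (tag x - tagged x) (tagged x).
by rewrite subnK // -ltnS ltn_ord.
Qed.

Definition jet r t (f : dhomog 3 K t) : 'M[K]_(n, #|{: jetidx r}|) :=
  \matrix_(i, j) (chg (A i) (val f))@_(jetmon t (enum_val j)).

Lemma jet_linear r t : linear (@jet r t).
Proof.
move=> c f g; apply/matrixP => i j.
by rewrite !mxE /= linearP /= mcoeffD mcoeffZ.
Qed.

HB.instance Definition _ r t :=
  GRing.isLinear.Build K (dhomog 3 K t) 'M[K]_(n, #|{: jetidx r}|) _ (@jet r t)
    (@jet_linear r t).

Definition vansp r t : {vspace dhomog 3 K t} := lker (linfun (@jet r t)).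

Lemma mem_vansp r t (f : dhomog 3 K t) : (f \in vansp r t) <-> vanish r (val f).
Proof.
rewrite memv_ker lfunE /=; split=> [/eqP/matrixP jf i m lt_m|vf].
  case: (eqVneq (mdeg m) t) => [dm|]; last first.
    by apply: dhomog_nemf_coeff; apply: dhomog_chg; apply: dhomog_is_dhomog.
  have lt_2 : (m i2 < (Ordinal lt_m).+1)%N by rewrite ltnS /= leq_addl.
  pose x : jetidx r := Tagged (fun e : 'I_r => 'I_e.+1) (Ordinal lt_2).
  have := jf i (enum_rank x); rewrite !mxE enum_rankK /jetmon /=.
  by rewrite addnK -{1}dm mdeg3 addnK -mnm3_eq.
apply/eqP/matrixP => i j; rewrite !mxE; apply: vf.
by rewrite jetmon_sum ltn_ord.
Qed.

Lemma dim_dhomog3 t : \dim {: dhomog 3 K t} = 'C(t.+2, 2).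
Proof. by rewrite dimvf /dim /= addn2 -bin_sub ?leqW // (_ : t.+2 - t = 2)%N //; lia. Qed.

(** Rank-nullity: order [r] at [n] points imposes at most n r(r+1)/2 linear conditions. *)
Lemma dim_vansp_ge r t : ('C(t.+2, 2) <= \dim (vansp r t) + n * 'C(r.+1, 2))%N.
Proof.
have := limg_ker_dim (linfun (@jet r t)) fullv.
rewrite capfv dim_dhomog3 => <-; rewrite leq_add2l.
apply: leq_trans (dimvS (subvf _)) _.
by rewrite dimvf /dim /= card_jetidx.
Qed.

Hypothesis sepA : forall i j, i != j ->
  exists l : {mpoly K[3]}, [/\ l \is 1.-homog, l.@[A j i0] = 0 & l.@[A i i0] != 0].

(** A product of [r]-th powers of lines, one for each other point, passing through that point and
    missing point [i]. *)
Lemma separating_form r i : exists d h,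
  [/\ h \is d.-homog, h.@[A i i0] != 0 & forall j, j != i -> van (A j) r h].
Proof.
suff [d [h [hd h0 hv]]] : exists d h, [/\ h \is d.-homog, h.@[A i i0] != 0 &
    forall j, j \in enum 'I_n -> j != i -> van (A j) r h].
  by exists d, h; split=> // j; apply: hv; rewrite mem_enum.
elim: (enum 'I_n) => [|k s [d [h [hd h0 hv]]]].
  by exists 0%N, 1; split; rewrite ?dhomog1 ?meval1 ?oner_neq0.
case: (eqVneq k i) => [->|ne_ki].
  exists d, h; split=> // j; rewrite inE => /orP[/eqP->|]; last exact: hv.
  by rewrite eqxx.
have ne_ik : i != k by rewrite eq_sym.
have [l [hl l0 l1]] := sepA ne_ik.
exists (1 * r + d)%N, (l ^+ r * h); split.
- by rewrite dhomogM ?dhomogMn.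
- by rewrite mevalM rmorphXn /= mulf_neq0 ?expf_neq0.
move=> j; rewrite inE => /orP[/eqP-> _|js ji]; last exact/vanMl/hv.
by rewrite mulrC; apply: vanMl; have := vanX (k := r) (van1 hl l0); rewrite mul1n.
Qed.

(** Multiplying [h] by local coordinates gives a form whose jet at point [i] is a nonzero multiple
    of the chosen basis jet plus jets of strictly higher order, and whose jets elsewhere vanish.
    Hence a descending induction on the order [tag x]. *)
Lemma delta_mx_jet r t i d h : h \is d.-homog -> h.@[A i i0] != 0 ->
    (forall j, j != i -> van (A j) r h) -> (r + d <= t)%N ->
  forall x : jetidx r, delta_mx i (enum_rank x) \in limg (linfun (@jet r t)).
Proof.
move=> hd h0 hv le_t x; move Dk: (r - tag x)%N => k.
elim/ltn_ind: k x Dk => k IH x Dk.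
have lt_e : (tag x < r)%N := ltn_ord _.
have le_b : (tagged x <= tag x)%N by rewrite -ltnS ltn_ord.
(* The first exponent brings the product with [h] to degree [t]; [r + d <= t] keeps the subtractions
   from truncating. *)
pose M := mnm3 (t - tag x - d) (tag x - tagged x) (tagged x).
have [M0 M1 M2] := mnm3E (t - tag x - d) (tag x - tagged x) (tagged x).
pose g : {mpoly K[3]} := h * chg (invmx (A i)) 'X_[M].
have hg : g \is t.-homog.
  have -> : t = (d + mdeg M)%N by rewrite mdeg_mnm3; lia.
  by rewrite dhomogM ?dhomog_chg // dhomogX.
have jetE j y : jet r (DHomog hg) j (enum_rank y) = (chg (A j) g)@_(jetmon t y).
  by rewrite mxE enum_rankK.
have jet0 j y : j != i -> jet r (DHomog hg) j y = 0.
  move=> ji; rewrite mxE; have : van (A j) (r + 0) g by apply: vanM => //; apply: hv.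
  by rewrite addn0; apply; rewrite jetmon_sum ltn_ord.
have jet_x : jet r (DHomog hg) i (enum_rank x) = h.@[A i i0].
  rewrite jetE (rmorphM (chg (A i))) /= chgVK // -(coef_chg0 (A i) hd).
  have -> : jetmon t x = (M + mnm3 d 0 0)%MM.
    have [T0 T1 T2] := mnm3E (t - tag x) (tag x - tagged x) (tagged x).
    have [D0 D1 D2] := mnm3E d 0 0.
    apply/mnmP; rewrite /jetmon; apply: ord3P.
    - by rewrite mnmDE T0 M0 D0 subnK //; lia.
    - by rewrite mnmDE T1 M1 D1 addn0.
    - by rewrite mnmDE T2 M2 D2 addn0.
  exact: mcoeffMX.
have jet_y y : y != x -> jet r (DHomog hg) i (enum_rank y) != 0 -> (tag x < tag y)%N.
  move=> ne_yx; rewrite jetE (rmorphM (chg (A i))) /= chgVK //.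
  rewrite -mcoeff_msupp (perm_mem (msuppMX _ _)) => /mapP[u _ Du].
  have := (congr1 (fun N : 'X_{1..3} => N i1) Du, congr1 (fun N : 'X_{1..3} => N i2) Du).
  rewrite !mnmDE M1 M2 /jetmon.
  have [_ -> ->] := mnm3E (t - tag y) (tag y - tagged y) (tagged y).
  have le_by : (tagged y <= tag y)%N by rewrite -ltnS ltn_ord.
  move=> [E1 E2]; rewrite ltnNge; apply/negP => le_yx.
  have arith (a b a' b' p q : nat) : (b <= a)%N -> (b' <= a')%N ->
      (a' - b' = a - b + p)%N -> (b' = b + q)%N -> (a' <= a)%N -> a' = a /\ b' = b.
    by lia.
  have [Et Eb] := arith _ _ _ _ _ _ le_b le_by E1 E2 le_yx.
  by case/eqP: ne_yx; apply: jetidx_eq.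
have jet_sum : jet r (DHomog hg) =
    \sum_y jet r (DHomog hg) i (enum_rank y) *: delta_mx i (enum_rank y).
  rewrite [LHS]matrix_sum_delta (bigD1 i) //= [X in _ + X]big1 ?addr0; last first.
    by move=> j ji; rewrite big1 // => y _; rewrite jet0 ?scale0r.
  by rewrite (reindex enum_rank) //=; apply/onW_bij/enum_rank_bij.
rewrite -[delta_mx _ _]scale1r -(mulVf h0) -scalerA memvZ //.
have -> : h.@[A i i0] *: delta_mx i (enum_rank x) = jet r (DHomog hg) -
    \sum_(y | y != x) jet r (DHomog hg) i (enum_rank y) *: delta_mx i (enum_rank y).
  by rewrite {1}jet_sum (bigD1 x) //= jet_x addrK.
rewrite memvB //; first by rewrite -[jet _ _](lfunE (@jet r t)) memv_img ?memvf.
apply: memv_suml => y ne_yx.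
have [->|/(jet_y y ne_yx) lt_xy] := eqVneq (jet r (DHomog hg) i (enum_rank y)) 0.
  by rewrite scale0r mem0v.
apply/memvZ/(IH (r - tag y)%N) => //; rewrite -Dk; exact: ltn_sub2l.
Qed.

(** In large degree the jets at the [n] points can be prescribed independently, by
    [delta_mx_jet]. *)
Lemma dim_vansp_le r : exists t0, forall t, (t0 <= t)%N ->
  (\dim (vansp r t) + n * 'C(r.+1, 2) <= 'C(t.+2, 2))%N.
Proof.
have [d] := fin_all_exists (separating_form r).
move=> hd; exists (r + \sum_i d i)%N => t le_t.
have := limg_ker_dim (linfun (@jet r t)) fullv.
rewrite capfv dim_dhomog3 => <-; rewrite leq_add2l.
suff -> : limg (linfun (@jet r t)) = fullv by rewrite dimvf /dim /= card_jetidx.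
apply/eqP; rewrite eqEsubv subvf; apply/subvP => M _.
rewrite [M]matrix_sum_delta; apply: memv_suml => i _; apply: memv_suml => y _.
rewrite memvZ // -[y]enum_valK; have [h [h1 h2 h3]] := hd i.
apply: delta_mx_jet h1 h2 h3 _ _.
by apply: leq_trans le_t; rewrite leq_add2l (bigD1 i) //= leq_addr.
Qed.

End Jets.

(** * Powers of an ideal generated by a regular pair *)

Section RegularPair.
Variable R : idomainType.
Implicit Types F G u v h : R.

(* For F != 0, this says that F, G is a regular sequence, except that the quotient
   may vanish. *)
Definition regpair F G := forall u v, F * u = G * v -> exists w, v = F * w.

Lemma regpairMr F G G' : regpair F G -> regpair F G' -> regpair F (G * G').
Proof.
move=> rG rG' u v; rewrite -mulrA => /rG[w e].
by apply: (rG' w); rewrite e.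
Qed.

Lemma regpairMl F F' G : F != 0 -> regpair F G -> regpair F' G -> regpair (F * F') G.
Proof.
move=> F0 rF rF' u v; rewrite -mulrA => e; have [w Dv] := rF _ _ e.
have /rF'[w' Dw] : F' * u = G * w by apply: (mulfI F0); rewrite e Dv mulrCA.
by exists w'; rewrite Dv Dw mulrA.
Qed.

Lemma regpairXr F G k : regpair F G -> regpair F (G ^+ k).
Proof.
move=> rG; elim: k => [|k IH]; first by move=> u v; rewrite mul1r => <-; exists u.
by rewrite exprS; apply: regpairMr.
Qed.

Lemma regpair_prodr F (I : Type) (s : seq I) (G : I -> R) :
  (forall i, regpair F (G i)) -> regpair F (\prod_(i <- s) G i).
Proof.
move=> rG; apply: big_ind => //; last exact: regpairMr.
by move=> u v; rewrite mul1r => <-; exists u.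
Qed.

Lemma regpair_prodl (I : Type) (s : seq I) (F : I -> R) G :
  (forall i, F i != 0) -> (forall i, regpair (F i) G) ->
  regpair (\prod_(i <- s) F i) G.
Proof.
move=> F0 rF; elim: s => [|i s IH]; first by rewrite big_nil => u v _; exists v; rewrite mul1r.
by rewrite big_cons; apply: regpairMl.
Qed.

Lemma regpairXl F G k : F != 0 -> regpair F G -> regpair (F ^+ k) G.
Proof. by move=> F0 rF; rewrite -(card_ord k) -prodr_const; apply: regpair_prodl. Qed.

Section Powers.
Variables (F G : R).
Hypotheses (F0 : F != 0) (FG : regpair F G).

Definition inFG h := exists u v, h = u * F + v * G.

(** The monomials of degree [k] in [F], [G] are independent modulo (F, G). [F] divides the term in
    the pure power of [G], hence divides [c 0] by regularity; that term is moved into the next one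
    and a factor [F] is cancelled. *)
Lemma quasi_regular k (c : nat -> R) :
  \sum_(i < k.+1) c i * (F ^+ i * G ^+ (k - i)) = 0 -> forall i, (i <= k)%N -> inFG (c i).
Proof.
elim: k c => [|k IH] c.
  rewrite big_ord1 /= !mulr1 => c0 [] // _; rewrite c0.
  by exists 0, 0; rewrite !mul0r addr0.
rewrite big_ord_recl /= mul1r subn0 => e.
set S := \sum_(i < k.+1) _ in e.
pose S' := \sum_(i < k.+1) c i.+1 * (F ^+ i * G ^+ (k - i)).
have DS : S = F * S'.
  rewrite mulr_sumr; apply: eq_bigr => i _; rewrite /= /bump /= add1n subSS exprS.
  by ring.
have [w Dw] : exists w, c 0%N = F * w.
  have E : F * (- S') = G ^+ k.+1 * c 0%N.
    by rewrite mulrN -DS mulrC; apply/esym/eqP; rewrite -addr_eq0 e.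
  exact: (regpairXr FG E).
pose c' i := c i.+1 + (if i == 0%N then w * G else 0).
have /IH inc' : \sum_(i < k.+1) c' i * (F ^+ i * G ^+ (k - i)) = 0.
  apply: (mulfI F0); rewrite mulr0 -[RHS]e DS Dw.
  rewrite /c'; under eq_bigr => i _ do rewrite mulrDl.
  rewrite big_split /= -/S' [X in _ + X]big_ord_recl /= mul1r subn0 big1 => [|i _].
    by rewrite exprS; ring.
  by rewrite mul0r.
case=> [_|i lt_ik]; first by exists w, 0; rewrite Dw mul0r addr0 mulrC.
have [u [v Dc]] := inc' i lt_ik.
exists u, (v - if i == 0%N then w else 0).
move: Dc; rewrite /c'; case: eqP => _ Dc; last by rewrite -[LHS]addr0 Dc subr0.
by rewrite -[LHS](addrK (w * G)) Dc; ring.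
Qed.

Variables (J : R -> Prop).
Hypotheses (J0 : J 0) (JD : forall u v, J u -> J v -> J (u + v)).
Hypotheses (JM : forall u v, J v -> J (u * v)) (JF : J F) (JG : J G).

Lemma J_inFG h : inFG h -> J h.
Proof. by case=> u [v ->]; apply: JD; apply: JM. Qed.

(* [(F, G)^k J] *)
Definition pencil k h := exists2 c : nat -> R, (forall i, J (c i)) &
  h = \sum_(i < k.+1) c i * (F ^+ i * G ^+ (k - i)).

Lemma pencilD k u v : pencil k u -> pencil k v -> pencil k (u + v).
Proof.
case=> c Jc -> [d Jd ->]; exists (fun i => c i + d i) => [i|]; first exact: JD.
by rewrite -big_split; apply: eq_bigr => i _; rewrite mulrDl.
Qed.

Lemma pencil_step k u v : pencil k u -> pencil k v -> pencil k.+1 (u * F + v * G).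
Proof.
case=> c Jc -> [d Jd ->].
pose e i := (if i is j.+1 then c j else 0) + (if (i <= k)%N then d i else 0).
exists e => [i|].
  by apply: JD; [case: i | case: ifP].
rewrite /e; under [RHS]eq_bigr => i _ do rewrite mulrDl.
rewrite big_split /= [X in _ = X + _]big_ord_recl /= mul0r add0r; congr (_ + _).
  rewrite mulr_suml; apply: eq_bigr => i _ /=; rewrite /bump /= add1n subSS exprS.
  by ring.
rewrite [RHS]big_ord_recr /= ltnn mul0r addr0 mulr_suml; apply: eq_bigr => i _ /=.
have le_ik : (i <= k)%N := leq_ord i.
by rewrite le_ik subSn // exprS; ring.
Qed.

Lemma pencilW k h : pencil k.+1 h -> pencil k h.
Proof.
case=> c Jc ->.
pose d i := c i * G + (if i == k then c k.+1 * F else 0).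
exists d => [i|].
  by rewrite /d mulrC; apply: JD; [apply: JM | case: ifP => // _; rewrite mulrC; apply: JM].
rewrite big_ord_recr /= subnn mulr1.
rewrite /d; under [RHS]eq_bigr => i _ do rewrite mulrDl.
rewrite big_split /=; congr (_ + _).
  apply: eq_bigr => i _ /=; have le_ik : (i <= k)%N := leq_ord i.
  by rewrite subSn // exprS; ring.
rewrite big_ord_recr /= eqxx subnn big1 ?add0r => [|i _]; last first.
  by rewrite ltn_eqF ?mul0r.
by rewrite exprS; ring.
Qed.

Variables (I : Type) (x : I -> R).
Hypothesis satFG : forall h, (forall i, inFG (x i * h)) -> inFG h.
Hypothesis satJ : forall h, (forall i, J (x i * h)) -> J h.

(* (F,G)^k / (F,G)^(k+1) is free over R / (F,G), so R / (F,G)^k J inherits depth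
   from R / (F,G) and R / J. *)
Lemma pencil_sat k h : (forall i, pencil k (x i * h)) -> pencil k h.
Proof.
elim: k h => [|k IH] h.
  move=> ph; exists (fun=> h); last by rewrite big_ord1 !mulr1.
  move=> _; apply: satJ => i; have [c Jc ->] := ph i.
  by rewrite big_ord1 !mulr1; apply: Jc.
move=> ph; have [d Jd Dh] : pencil k h by apply: IH => i; apply/pencilW/ph.
(* Two expressions of [x i * h] in the monomials of degree [k] are compared: one comes from [d], the
   other, [q], from [c] with one factor moved into each coefficient. *)
have inFGd j : (j <= k)%N -> inFG (d j).
  move=> le_jk; apply: satFG => i; have [c Jc Dc] := ph i.
  pose q l := c l * G + (if l == k then c k.+1 * F else 0).
  have : \sum_(l < k.+1) (x i * d l - q l) * (F ^+ l * G ^+ (k - l)) = 0.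
    under eq_bigr => l _ do rewrite mulrBl -mulrA.
    rewrite sumrB -mulr_sumr -Dh Dc; apply/eqP; rewrite subr_eq0; apply/eqP.
    rewrite big_ord_recr /= subnn mulr1 /q.
    under [RHS]eq_bigr => l _ do rewrite mulrDl.
    rewrite big_split /=; congr (_ + _).
      apply: eq_bigr => l _ /=; have le_lk : (l <= k)%N := leq_ord l.
      by rewrite subSn // exprS; ring.
    rewrite big_ord_recr /= eqxx subnn big1 ?add0r => [|l _]; last first.
      by rewrite ltn_eqF ?mul0r.
    by rewrite exprS; ring.
  move/(quasi_regular (c := fun l => x i * d l - q l)) => /(_ j le_jk)[u [v /eqP]].
  rewrite subr_eq => /eqP->.
  rewrite /q; exists (u + if j == k then c k.+1 else 0), (v + c j).
  by case: ifP => _; ring.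
have [e De] : exists e : nat -> R * R, forall j, (j <= k)%N -> d j = (e j).1 * F + (e j).2 * G.
  have [f Df] : exists f : 'I_k.+1 -> R * R, forall j : 'I_k.+1, d j = (f j).1 * F + (f j).2 * G.
    apply: (@fin_all_exists 'I_k.+1 (fun=> (R * R)%type)
      (fun j p => d j = p.1 * F + p.2 * G)) => j; have [u [v Dd]] := inFGd j (leq_ord j).
    by exists (u, v).
  by exists (fun j => f (inord j)) => j le_jk; rewrite -Df inordK.
(* Expanding each [d j] along [F] and [G] rewrites [h] in the monomials of degree [k.+1]. *)
pose g i := (if i is j.+1 then (e j).1 else 0) + (if (i <= k)%N then (e i).2 else 0).
have Dg : h = \sum_(i < k.+2) g i * (F ^+ i * G ^+ (k.+1 - i)).
  rewrite /g; under [RHS]eq_bigr => i _ do rewrite mulrDl.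
  rewrite big_split /= [X in X + _]big_ord_recl /= mul0r add0r.
  rewrite [X in _ + X]big_ord_recr /= ltnn mul0r addr0 -big_split Dh /=.
  apply: eq_bigr => i _; have le_ik : (i <= k)%N := leq_ord i.
  by rewrite De // le_ik /bump /= add1n subSS subSn // !exprS; ring.
(* [x l * g i] differs from [c i] by an element of (F, G), which [J] contains; [satJ] then removes
   [x l]. *)
have Jg i : (i <= k.+1)%N -> J (g i).
  move=> le_ik; apply: satJ => l; have [c Jc Dc] := ph l.
  have : \sum_(j < k.+2) (x l * g j - c j) * (F ^+ j * G ^+ (k.+1 - j)) = 0.
    under eq_bigr => j _ do rewrite mulrBl -mulrA.
    by rewrite sumrB -mulr_sumr -Dg Dc subrr.
  move/(quasi_regular (c := fun j => x l * g j - c j)) => /(_ i le_ik)/J_inFG Jd'.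
  by rewrite -[x l * g i](subrK (c i)); apply: JD.
exists (fun i => if (i <= k.+1)%N then g i else 0) => [i|].
  by case: ifP => // /Jg.
by rewrite {1}Dg; apply: eq_bigr => i _; rewrite leq_ord.
Qed.

End Powers.
End RegularPair.

(** * Setting some of the variables to zero *)

Section Kill.
Variables (K : fieldType) (n : nat).

Definition killX (P : pred 'I_n) (f : {mpoly K[n]}) : {mpoly K[n]} :=
  f \mPo [tuple if P j then 0 else 'X_j | j < n].

HB.instance Definition _ P :=
  GRing.isZmodMorphism.Build {mpoly K[n]} {mpoly K[n]} (killX P)
    (raddfB (comp_mpoly [tuple if P j then 0 else 'X_j | j < n])).
HB.instance Definition _ P :=
  GRing.isMonoidMorphism.Build {mpoly K[n]} {mpoly K[n]} (killX P)
    (rmorphism_monoidP (comp_mpoly [tuple if P j then 0 else 'X_j | j < n])).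

Lemma mpolyX_neq0 m : 'X_[m] != 0 :> {mpoly K[n]}.
Proof. by rewrite -msupp_eq0 msuppX. Qed.

#[global] Arguments killX : simpl never.

Lemma killXU P j : killX P 'X_j = if P j then 0 else 'X_j.
Proof. by rewrite /killX comp_mpolyXU -tnth_nth tnth_mktuple. Qed.

(** The set of such [f] is closed under sums and products and contains the constants and the
    variables. *)
Lemma killXE P f : exists w, f = killX P f + \sum_(j | P j) 'X_j * w j.
Proof.
pose S f := exists w, f = killX P f + \sum_(j | P j) 'X_j * w j.
have SD u v : S u -> S v -> S (u + v).
  case=> a Du [b Dv]; exists (fun j => a j + b j).
  rewrite rmorphD {1}Du {1}Dv addrACA -big_split; congr (_ + _).
  by apply: eq_bigr => j _; rewrite mulrDr.
have SM u v : S u -> S v -> S (u * v).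
  case=> a Du [b Dv]; exists (fun j => a j * v + killX P u * b j).
  have -> : \sum_(j | P j) 'X_j * (a j * v + killX P u * b j) =
    (\sum_(j | P j) 'X_j * a j) * v + killX P u * \sum_(j | P j) 'X_j * b j.
    rewrite mulr_suml mulr_sumr -big_split; apply: eq_bigr => j _ /=; ring.
  by rewrite rmorphM /= {1}Du mulrDl {1}Dv mulrDr -addrA [X in _ + X]addrC.
have SC c : S c%:MP.
  by exists (fun=> 0); rewrite /killX comp_mpolyC big1 ?addr0 // => j _; rewrite mulr0.
have SX j : S 'X_j.
  rewrite /S killXU; case: ifP => Pj; last first.
    by exists (fun=> 0); rewrite big1 ?addr0 // => i _; rewrite mulr0.
  exists (fun i => (i == j)%:R); rewrite add0r (bigD1 j) //= eqxx mulr1 big1 ?addr0 //.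
  by move=> i /andP[_ /negbTE->]; rewrite mulr0.
elim/mpolyind: f => [|c m p _ _ IH]; first exact: (SC 0).
apply: SD => //; rewrite -mul_mpolyC; apply: (SM); first exact: SC.
rewrite mpolyXE_id; elim/big_rec: _ => [|j q _ Sq]; first exact: (SC 1).
apply: (SM) Sq; elim: (m j) => [|k IHk]; [exact: (SC 1) | rewrite exprS; exact: SM _ _ (SX j) IHk].
Qed.

(** Modulo ['X_i] the ring is still a domain and ['X_j] stays nonzero. *)
Lemma dvd_X_mulX (i j : 'I_n) (f g : {mpoly K[n]}) :
  i != j -> 'X_j * f = 'X_i * g -> exists w, f = 'X_i * w.
Proof.
move=> ne_ij /(congr1 (killX (pred1 i))); rewrite !rmorphM /= !killXU /= eqxx mul0r.
rewrite eq_sym (negbTE ne_ij) => /eqP; rewrite mulf_eq0 (negbTE (mpolyX_neq0 _)) => /eqP k0.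
have [w Df] := killXE (pred1 i) f; exists (w i).
by rewrite Df k0 add0r big_pred1_eq.
Qed.

End Kill.

(** * Positive depth of the quotient by a regular pair *)

Section Koszul.
Variable K : fieldType.
Implicit Types F G h : {mpoly K[3]}.

(** With x_i h = u_i F + v_i G, regularity makes x_j u_i - x_i u_j a multiple of G and x_i v_j - x_j
    v_i the same multiple of F. The three multipliers satisfy a Koszul relation, which puts the
    first one in (x_0, x_1); correcting u_0 and v_0 by it makes both divisible by x_0. *)
Lemma inFG_sat F G h : F != 0 -> regpair F G ->
  (forall i : 'I_3, inFG F G ('X_i * h)) -> inFG F G h.
Proof.
move=> F0 FG xh.
have [u0 [v0 E0]] := xh i0; have [u1 [v1 E1]] := xh i1; have [u2 [v2 E2]] := xh i2.
pose x i : {mpoly K[3]} := 'X_i.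
have syz i j ui vi uj vj : x i * h = ui * F + vi * G -> x j * h = uj * F + vj * G ->
    exists w, x i * vj - x j * vi = F * w /\ x j * ui - x i * uj = G * w.
  move=> Ei Ej.
  have E : F * (x j * ui - x i * uj) = G * (x i * vj - x j * vi).
    have : x j * (ui * F + vi * G) = x i * (uj * F + vj * G) by rewrite -Ei -Ej mulrCA.
    by move/eqP; rewrite -subr_eq0 => /eqP e; apply/eqP; rewrite -subr_eq0 -e; apply/eqP; ring.
  have [w Dw] := FG _ _ E; exists w; split=> //.
  by apply: (mulfI F0); rewrite E Dw; ring.
have [w [Fw Gw]] := syz _ _ _ _ _ _ E0 E1.
have [w' [Fw' _]] := syz _ _ _ _ _ _ E0 E2.
have [w'' [Fw'' _]] := syz _ _ _ _ _ _ E1 E2.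
have kos : x i2 * w - x i1 * w' + x i0 * w'' = 0.
  apply: (mulfI F0); rewrite mulr0.
  rewrite (_ : F * _ = x i2 * (F * w) - x i1 * (F * w') + x i0 * (F * w'')); last by ring.
  by rewrite -Fw -Fw' -Fw''; ring.
(* Modulo the first two variables, the relation [kos] reads x_2 w = 0. *)
pose P := [pred i : 'I_3 | i != i2].
have kw : killX P w = 0.
  have := congr1 (killX P) kos; rewrite rmorph0 rmorphD rmorphB !rmorphM /= !killXU /=.
  by rewrite !mul0r subr0 addr0 => /eqP; rewrite mulf_eq0 (negbTE (mpolyX_neq0 _ _)) => /eqP.
have [a [b Dw]] : exists a b, w = x i0 * a + x i1 * b.
  have [c Dc] := killXE P w; exists (c i0), (c i1).
  by rewrite {1}Dc kw add0r big_mkcond big_ord3 /= addr0.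
have [p Dp] : exists p, u0 - b * G = x i0 * p.
  apply: (@dvd_X_mulX _ _ i0 i1 _ (u1 + a * G)) => //.
  have -> : 'X_i1 * (u0 - b * G) = (x i1 * u0 - x i0 * u1) + x i0 * u1 - x i1 * b * G.
    by rewrite /x; ring.
  by rewrite Gw Dw -/(x i0); ring.
have [q Dq] : exists q, v0 + b * F = x i0 * q.
  apply: (@dvd_X_mulX _ _ i0 i1 _ (v1 - a * F)) => //.
  have -> : 'X_i1 * (v0 + b * F) = x i0 * v1 + x i1 * b * F - (x i0 * v1 - x i1 * v0).
    by rewrite /x; ring.
  by rewrite Fw Dw -/(x i0); ring.
exists p, q; apply: (@mulfI _ (x i0)); first exact: mpolyX_neq0.
rewrite E0 mulrDr !mulrA -Dp -Dq; ring.
Qed.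

End Koszul.

(** * Dimension counts *)

Section Multiplication.
Variable K : fieldType.
Implicit Types F G : {mpoly K[3]}.

Lemma pihomog_mull d e F w : F \is d.-homog ->
  pihomog mdeg (d + e) (F * w) = F * pihomog mdeg e w.
Proof.
move=> hF; have [k lek] := ex_intro (fun k => msize w <= k)%N _ (leqnn _).
have lek' : (msize w <= k + e.+1)%N by rewrite (leq_trans lek) ?leq_addr.
rewrite [in LHS](pihomog_partitionE lek') mulr_sumr (raddf_sum (pihomog mdeg (d + e))) /=.
have lt_e : (e < k + e.+1)%N by rewrite addnS ltnS leq_addl.
have hom j : F * pihomog mdeg j w \is (d + j).-homog by rewrite dhomogM ?pihomogP.
rewrite (bigD1 (Ordinal lt_e)) //= (pihomog_dE (hom e)) big1 ?addr0 // => j ne_je.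
by rewrite (pihomog_ne0 _ (hom j)) // eqn_add2l.
Qed.

(** Projection to degree [t] makes the map total in [s] and [t]; it is multiplication by [F] once
    the degrees add up, as in [mulhE]. *)
Definition mulh F s t (p : dhomog 3 K s) : dhomog 3 K t :=
  DHomog (pihomogP mdeg t (F * val p)).

Lemma mulh_linear F s t : linear (@mulh F s t).
Proof.
move=> c p q; apply: val_inj => /=.
by rewrite mulrDr -scalerAr linearP.
Qed.

HB.instance Definition _ F s t :=
  GRing.isLinear.Build K (dhomog 3 K s) (dhomog 3 K t) _ (@mulh F s t) (@mulh_linear F s t).

Lemma mulhE F d s t p : F \is d.-homog -> (d + s)%N = t -> val (@mulh F s t p) = F * val p.
Proof.
by move=> hF <-; rewrite /= pihomog_dE // dhomogM // dhomog_is_dhomog.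
Qed.

Definition lmulh F s t : 'Hom(dhomog 3 K s, dhomog 3 K t) := linfun (@mulh F s t).

Lemma dim_lmulh F d s t U : F != 0 -> F \is d.-homog -> (d + s)%N = t ->
  \dim (lmulh F s t @: U) = \dim U.
Proof.
move=> F0 hF e; apply: limg_dim_eq; apply/eqP; rewrite -subv0; apply/subvP => p.
rewrite memv_cap memv_ker memv0 lfunE /= => /andP[_ /eqP/(congr1 val)].
rewrite (mulhE _ hF e) /= => /eqP; rewrite mulf_eq0 (negbTE F0) /=.
by move/eqP => p0; apply/eqP/val_inj.
Qed.

End Multiplication.

Lemma mul2_binS x : (2 * 'C(x.+1, 2) = x.+1 * x)%N.
Proof. by have := mul_bin_diag x.+1 1; rewrite bin1. Qed.

Section Count.
Variables (K : fieldType) (n : nat) (A : 'I_n -> 'M[K]_3).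
Hypothesis uA : forall i, A i \in unitmx.
Hypothesis sepA : forall i j, i != j ->
  exists l : {mpoly K[3]}, [/\ l \is 1.-homog, l.@[A j i0] = 0 & l.@[A i i0] != 0].

Variables (F G : {mpoly K[3]}) (da db m : nat).
Hypotheses (hF : F \is da.-homog) (hG : G \is db.-homog).
Hypotheses (vF : vanish A m F) (vG : vanish A m G).
Hypotheses (F0 : F != 0) (FG : regpair F G) (G0 : G != 0).

Let V := vansp A.
(** The space F I(s)_(t-a) + G I(s)_(t-b) for t = da + db + c; here [c] is the degree of the forms
    [w] in the overlap wFG. *)
Let imFG s c := (lmulh F (db + c) (da + db + c) @: V s (db + c) +
                 lmulh G (da + c) (da + db + c) @: V s (da + c))%VS.

Lemma imFG_sub s c : (imFG s c <= V (s + m) (da + db + c))%VS.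
Proof.
rewrite subv_add; apply/andP; split; apply/subvP => _ /memv_imgP[p /mem_vansp vp ->].
  apply/mem_vansp => i; rewrite lfunE (mulhE _ hF) ?addnA // addnC.
  by apply: vanM; [apply: vF | apply: vp].
apply/mem_vansp => i; rewrite lfunE (mulhE _ hG); last by lia.
by rewrite addnC; apply: vanM; [apply: vG | apply: vp].
Qed.

(** If F u = G v, regularity gives u = G w and v = F w, so by [ker] the overlap of the two summands
    lies in F G I(r)_c; the dimension formula for a sum does the rest. *)
Lemma imFG_dim s r c :
  (forall w, vanish A s (F * w) -> vanish A s (G * w) -> vanish A r w) ->
  (\dim (V s (db + c)) + \dim (V s (da + c)) <= \dim (imFG s c) + \dim (V r c))%N.
Proof.
move=> ker.
have ea : (da + (db + c) = da + db + c)%N by lia.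
have eb : (db + (da + c) = da + db + c)%N by lia.
rewrite -(dim_lmulh _ F0 hF ea) -(dim_lmulh _ G0 hG eb) -dimv_sum_cap leq_add2l.
have FG0 : F * G != 0 by rewrite mulf_neq0.
rewrite -(dim_lmulh (V r c) FG0 (dhomogM hF hG) erefl); apply: dimvS.
apply/subvP => h; rewrite memv_cap => /andP[/memv_imgP[p vp Dp] /memv_imgP[q vq Dq]].
have := congr1 val (etrans (esym Dp) Dq).
rewrite !lfunE (mulhE p hF ea) (mulhE q hG eb) => e; have [w Dw] := FG e.
have Dp' : val p = G * w by apply: (mulfI F0); rewrite e Dw mulrCA.
have hw : w \is c.-homog.
  rewrite homog_piE; apply/eqP; apply: (mulfI F0); rewrite -Dw.
  by rewrite -(pihomog_mull _ _ hF) -Dw pihomog_dE // dhomog_is_dhomog.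
apply/memv_imgP; exists (DHomog hw).
  apply/mem_vansp; apply: ker => /=; first by rewrite -Dw; apply/mem_vansp.
  by rewrite -Dp'; apply/mem_vansp.
apply: val_inj; rewrite Dp !lfunE (mulhE p hF ea) (mulhE _ (dhomogM hF hG)) //= Dp'.
by rewrite mulrA.
Qed.

(* Compare dimensions in F I^(m) + G I^(m), a subspace of I^(2m), in large degree. *)
Theorem bezout_vanish : (m ^ 2 * n <= da * db)%N.
Proof.
have [t0 ht0] := dim_vansp_le uA sepA (m + m).
have := @imFG_dim m 0 t0 (fun _ _ _ _ => @van0 _ _ _).
have := ht0 (da + db + t0)%N (leq_addl _ _).
have := dimvS (imFG_sub m t0).
have := dim_vansp_ge A m (db + t0).
have := dim_vansp_ge A m (da + t0).
have := dimvS (subvf (V 0 t0)); rewrite dim_dhomog3.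
have := mul2_binS (da + t0).+1; have := mul2_binS (db + t0).+1.
have := mul2_binS (da + db + t0).+1; have := mul2_binS t0.+1.
have := congr1 (muln n) (mul2_binS m); have := congr1 (muln n) (mul2_binS (m + m)).
(* The binomials in degrees [da + db + t0], [da + t0], [db + t0], [t0] combine to da db, and those
   in orders 2m and m, times [n], to n m^2. *)
rewrite /V -mulnn; move: (\dim _) (\dim _) (\dim _) (\dim _) (\dim _).
move: ('C(_, 2)) ('C(_, 2)) ('C(_, 2)) ('C(_, 2)) ('C(_, 2)) ('C(_, 2)) => *.
lia.
Qed.
Hypothesis eq_ab : (da * db = m ^ 2 * n)%N.

(** The second difference of x(x+1)/2 with step [m] is m^2. So under [eq_ab] the lower bound of
    [imFG_dim] for orders r + m and r reaches the dimension of I(r+2m) in large degree, and the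
    inclusion [imFG_sub] is an equality. *)
Lemma imFG_full r :
  (forall w, vanish A (r + m) (F * w) -> vanish A (r + m) (G * w) -> vanish A r w) ->
  exists t0, forall t h, (t0 <= t)%N -> h \is t.-homog -> vanish A (r + m + m) h ->
    exists u v, [/\ vanish A (r + m) u, vanish A (r + m) v & h = F * u + G * v].
Proof.
move=> ker.
have [t1 ht1] := dim_vansp_le uA sepA (r + m + m).
have [t2 ht2] := dim_vansp_le uA sepA r.
(* Both I(r+2m) in degree [t] and I(r) in degree [t - (da + db)] must have their expected
   dimension. *)
exists (da + db + (t1 + t2))%N => t h le_t hh vh.
have [c Dt] : exists c, t = (da + db + c)%N by exists (t - (da + db))%N; lia.
have le_c : (t1 + t2 <= c)%N by move: le_t; rewrite Dt leq_add2l.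
rewrite {}Dt in hh le_t.
suff /subvP sub : (V (r + m + m) (da + db + c) <= imFG (r + m) c)%VS.
  have /sub/memv_addP[_ /memv_imgP[u vu ->] [_ /memv_imgP[v vv ->] Dh]] :
    DHomog hh \in V (r + m + m) (da + db + c) by apply/mem_vansp.
  have ea : (da + (db + c) = da + db + c)%N by lia.
  have eb : (db + (da + c) = da + db + c)%N by lia.
  exists (val u), (val v); split; [exact/mem_vansp | exact/mem_vansp |].
  rewrite -(mulhE u hF ea) -(mulhE v hG eb) -[LHS]/(val (DHomog hh)) Dh.
  by rewrite !lfunE.
suff /eqP <- : imFG (r + m) c == V (r + m + m) (da + db + c) by [].
rewrite eqEdim imFG_sub.
have := @imFG_dim (r + m) r c ker.
have := ht1 (da + db + c)%N (leq_trans (leq_addr _ _) (leq_trans le_c (leq_addl _ _))).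
have := ht2 c (leq_trans (leq_addl _ _) le_c).
have := dim_vansp_ge A (r + m) (db + c).
have := dim_vansp_ge A (r + m) (da + c).
have := mul2_binS (da + c).+1; have := mul2_binS (db + c).+1.
have := mul2_binS (da + db + c).+1; have := mul2_binS c.+1.
have := congr1 (muln n) (mul2_binS (r + m)).
have := congr1 (muln n) (mul2_binS (r + m + m)).
have := congr1 (muln n) (mul2_binS r).
move: eq_ab; rewrite /V -mulnn.
move: (\dim _) (\dim _) (\dim _) (\dim _) (\dim _).
move: ('C(_, 2)) ('C(_, 2)) ('C(_, 2)) ('C(_, 2)) ('C(_, 2)) ('C(_, 2)) ('C(_, 2)) => *.
lia.
Qed.

(** For [q] in I(2m) of order exactly 2m at point [i], with q = F u + G v, the product q w = (F w) u
    + (G w) v has order at least r + 2m there, which leaves order at least r for [w]. *)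
Lemma vanish_colon r w :
  vanish A (r + m) (F * w) -> vanish A (r + m) (G * w) -> vanish A r w.
Proof.
move=> vFw vGw i.
have [|t0 ht0] := @imFG_full 0; first by move=> u _ _ j; apply: van0.
have [d [h [hd h0 hv]]] := separating_form sepA (m + m) i.
pose y k : {mpoly K[3]} := chg (invmx (A i)) 'X_k.
have hy k : y k \is 1.-homog by apply/dhomog_chg/dhomogXU.
have ey k : (y k).@[A i i0] = (k == i0)%:R by rewrite eval_chg0 chgVK ?mevalXU.
have vy : van (A i) 1 (y i1) by apply: van1 (hy _) _; rewrite ey.
(* The power of [y i1] has order exactly 2m at point [i], the power of [y i0] brings the degree to
   at least [t0], and [h] supplies order 2m at the other points. *)
pose q := y i1 ^+ (m + m) * (y i0 ^+ t0 * h).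
have hz : y i0 ^+ t0 * h \is (1 * t0 + d).-homog by rewrite dhomogM ?dhomogMn.
have hq : q \is (1 * (m + m) + (1 * t0 + d)).-homog by rewrite dhomogM ?dhomogMn.
have vq : vanish A (0 + m + m) q.
  move=> j; case: (eqVneq j i) => [->|ji]; last by apply/vanMl/vanMl/hv.
  by rewrite /q mulrC; apply: vanMl; have := vanX (k := m + m) vy; rewrite mul1n.
have [|u [v [vu vv Dq]]] := ht0 _ _ _ hq vq; first by lia.
have vwq : van (A i) (r + (m + m)) (y i1 ^+ (m + m) * (y i0 ^+ t0 * h * w)).
  rewrite mulrA -/q Dq mulrDl mulrAC [G * v * w]mulrAC addnA.
  by apply: vanD; apply: vanM.
have := van_X1n (uA i) vwq; apply: van_cancel hz _.
by rewrite mevalM rmorphXn /= ey eqxx expr1n mul1r.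
Qed.

(** At each point some variable is nonzero, hence can be cancelled there. *)
Lemma vanish_sat h : (forall j : 'I_3, vanish A m ('X_j * h)) -> vanish A m h.
Proof.
move=> vxh i.
have [j Aj] : exists j, A i i0 j != 0.
  apply/existsP; apply: contraTT (uA i) => /existsPn A0.
  rewrite unitmxE (expand_det_row _ i0) big1 ?unitr0 // => j _.
  by have := A0 j; rewrite negbK => /eqP->; rewrite mul0r.
by apply: van_cancel (dhomogXU _ j) _ (vxh j i); rewrite mevalXU.
Qed.

(** Induction on [k]: in large degree, [imFG_full] at r = m k splits off one factor from (F, G).
    Lower degrees are reached by multiplying with monomials of degree [t0] and applying [pencil_sat]
    repeatedly. *)
Lemma pencil_vanish k h : vanish A (m * k.+1) h -> pencil F G (vanish A m) k h.
Proof.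
have vD u v : vanish A m u -> vanish A m v -> vanish A m (u + v) by move=> vu vv i; apply: vanD.
have vM u v : vanish A m v -> vanish A m (u * v) by move=> vv i; apply: vanMl.
have v0 : vanish A m 0 by move=> i; apply: van_zero.
have sat_mon N j f : (forall M : 'X_{1..3}, mdeg M = N -> pencil F G (vanish A m) j ('X_[M] * f)) ->
    pencil F G (vanish A m) j f.
  elim: N f => [|N IH] f pf; first by have := pf 0%MM mdeg0; rewrite mpolyX0 mul1r.
  apply: (pencil_sat F0 FG v0 vD vM vF vG (fun g => inFG_sat F0 FG (h := g)) vanish_sat) => i.
  apply: IH => M dM; rewrite mulrCA mulrA -mpolyXD; apply: pf.
  by rewrite mdegD mdeg1 dM add1n.
elim: k h => [|k IH] h vh.
  by exists (fun=> h); [rewrite muln1 in vh | rewrite big_ord1 !mulr1].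
have [t0 ht0] := imFG_full (@vanish_colon (m * k)).
have [l lel] := ex_intro (fun l => msize h <= l)%N _ (leqnn _).
rewrite (pihomog_partitionE lel); apply: big_ind => [||e _].
- by exists (fun=> 0) => //; rewrite big1 // => i _; rewrite mul0r.
- exact: pencilD.
apply: (sat_mon t0) => M dM.
have [|||u [v [vu vv ->]]] := ht0 (t0 + e)%N ('X_[M] * pihomog mdeg e h).
- exact: leq_addr.
- by rewrite dhomogM ?pihomogP // dhomogX; apply/eqP.
- move=> i; apply/vanMl/van_pihomog.
  by have := vh i; rewrite !mulnS; congr van; lia.
rewrite [F * u]mulrC [G * v]mulrC; apply: pencil_step => //; apply: IH.
  by rewrite mulnS addnC.
by rewrite mulnS addnC.
Qed.

End Count.

(** * Base change to K(t) and descent *)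

Section IdealPowers.
Variable R : comNzRingType.
Implicit Types (S J : R -> Prop) (f g h : R).

Definition is_ideal J :=
  [/\ J 0, forall f g, J f -> J g -> J (f + g) & forall f g, J g -> J (f * g)].

Lemma ideal_gen_ideal S : is_ideal (ideal_gen S).
Proof.
split.
- by exists [::]; rewrite big_nil.
- move=> f g [s [Ss ->]] [s' [Ss' ->]]; exists (s ++ s'); rewrite big_cat.
  by split=> // x; rewrite mem_cat => /orP[/Ss|/Ss'].
move=> f g [s [Ss ->]]; exists [seq (f * x.1, x.2) | x <- s]; split.
  by move=> _ /mapP[x /Ss Sx ->].
by rewrite big_map mulr_sumr; apply: eq_bigr => x _; rewrite mulrA.
Qed.

Lemma sub_ideal_gen S f : S f -> ideal_gen S f.
Proof.
move=> Sf; exists [:: (1, f)]; rewrite big_seq1 mul1r; split=> // x.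
by rewrite inE => /eqP->.
Qed.

Lemma ideal_gen_sub S J : is_ideal J -> (forall f, S f -> J f) ->
  forall f, ideal_gen S f -> J f.
Proof.
case=> J0 JD JM SJ _ [s [Ss ->]]; elim: s Ss => [|x s IH] Ss; first by rewrite big_nil.
rewrite big_cons; apply: JD; first by apply/JM/SJ/Ss; rewrite mem_head.
by apply: IH => y ys; apply: Ss; rewrite inE ys orbT.
Qed.

Lemma ideal_pow_ideal J k : is_ideal (ideal_pow J k).
Proof. by case: k => [|k]; [split | apply: ideal_gen_ideal]. Qed.

Lemma mem_ideal_mul J1 J2 f g : J1 f -> J2 g -> ideal_mul J1 J2 (f * g).
Proof. by move=> J1f J2g; apply: sub_ideal_gen; exists f, g. Qed.

Lemma mem_ideal_powX J i k f g :
  J f -> ideal_pow J k g -> ideal_pow J (i + k) (f ^+ i * g).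
Proof.
move=> Jf pg; elim: i => [|i IH]; first by rewrite mul1r.
by rewrite exprS -mulrA; apply: mem_ideal_mul.
Qed.

Lemma ideal_powW J k r f : (r <= k)%N -> ideal_pow J k f -> ideal_pow J r f.
Proof.
elim: k f => [|k IH] f; first by rewrite leqn0 => /eqP->.
rewrite leq_eqVlt => /predU1P[-> //|lt_rk] pf; apply: IH => //.
have idJ := ideal_pow_ideal J k; apply: (ideal_gen_sub idJ) pf => h [u [v [_ pv ->]]].
by case: idJ => _ _; apply.
Qed.

Lemma ideal_pow_sub J1 J2 k f :
  (forall g, J1 g -> J2 g) -> ideal_pow J1 k f -> ideal_pow J2 k f.
Proof.
move=> sub; elim: k f => [//|k IH] f pf.
apply: (ideal_gen_sub (ideal_pow_ideal J2 k.+1)) pf => h [u [v [Ju Jv ->]]].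
by apply: mem_ideal_mul; [apply: sub | apply: IH].
Qed.

Lemma coef_idealM J1 J2 (P Q : {poly R}) : (forall i, J1 P`_i) -> (forall i, J2 Q`_i) ->
  forall i, ideal_mul J1 J2 (P * Q)`_i.
Proof.
move=> J1P J2Q i.
have [I0 ID _] := ideal_gen_ideal (fun h => exists f g, [/\ J1 f, J2 g & h = f * g]).
by rewrite coefM; apply: big_ind => // j _; apply: mem_ideal_mul.
Qed.

Lemma coef_idealX J (P Q : {poly R}) i k : (forall l, J P`_l) ->
  (forall l, ideal_pow J k Q`_l) -> forall l, ideal_pow J (i + k) (P ^+ i * Q)`_l.
Proof.
move=> JP JQ; elim: i => [|i IH]; first by rewrite mul1r.
by rewrite exprS -mulrA; apply: coef_idealM.
Qed.

End IdealPowers.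

Lemma polyC_addX_eq0 (R : nzRingType) (c d : R) : c%:P + d%:P * 'X = 0 -> c = 0.
Proof.
by move=> /(congr1 (fun P : {poly R} => P`_0)); rewrite coefD coefC coefMX /= addr0 coef0.
Qed.

(** * Coprimality of a generic combination *)

Section GenericCombination.
Variable R : idomainType.

(* Modulo F, comparing coefficients from below (resp. above) shows that powers of
   g1 (resp. g2) kill every coefficient of V. *)
Lemma regpair_generic (F g1 g2 : R) : F != 0 -> g1 != 0 -> regpair g1 g2 ->
  regpair F%:P (g1%:P + g2%:P * 'X).
Proof.
move=> F0 g0 rg U V e.
have coefE i : F * U`_i.+1 = g1 * V`_i.+1 + g2 * V`_i.
  by rewrite -coefCM e mulrDl coefD coefCM -mulrA coefCM coefXM.
have coef0 : F * U`_0 = g1 * V`_0.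
  by rewrite -coefCM e mulrDl coefD coefCM -mulrA coefCM coefXM /= mulr0 addr0.
have up i : exists w, g1 ^+ i.+1 * V`_i = F * w.
  elim: i => [|i [w IH]]; first by exists U`_0; rewrite coef0.
  exists (g1 ^+ i.+1 * U`_i.+1 - g2 * w).
  have -> : g1 ^+ i.+2 * V`_i.+1 = g1 ^+ i.+1 * (F * U`_i.+1) - g2 * (g1 ^+ i.+1 * V`_i).
    by rewrite coefE exprS; ring.
  by rewrite IH; ring.
(* The descent starts at index [size V], where the coefficient of [V] is 0. *)
have down j i : (i + j)%N = size V -> exists w, g2 ^+ j * V`_i = F * w.
  elim: j i => [|j IH] i; first by rewrite addn0 => ->; exists 0; rewrite nth_default // !mulr0.
  rewrite addnS -addSn => /IH[w Dw]; exists (g2 ^+ j * U`_i.+1 - g1 * w).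
  have -> : g2 ^+ j.+1 * V`_i = g2 ^+ j * (F * U`_i.+1) - g1 * (g2 ^+ j * V`_i.+1).
    by rewrite coefE exprS; ring.
  by rewrite Dw; ring.
have dvd i : exists w, V`_i = F * w.
  have [lt_i|le_i] := ltnP i (size V); last by exists 0; rewrite nth_default // mulr0.
  have [a Da] := up i; have [b Db] := down (size V - i)%N i (subnKC (ltnW lt_i)).
  have gi0 : g1 ^+ i.+1 != 0 by rewrite expf_neq0.
  (* These powers of [g1] and [g2] again form a regular pair, so [F], dividing both multiples of the
     coefficient, divides the coefficient itself. *)
  have rgX : regpair (g1 ^+ i.+1) (g2 ^+ (size V - i)) by apply/regpairXl/regpairXr.
  have [|w Dw] := rgX b a.
    apply: (mulfI F0); rewrite mulrCA -Db [RHS]mulrCA -Da; ring.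
  by exists w; apply: (mulfI gi0); rewrite Da Dw mulrCA.
have [w Dw] : exists w : 'I_(size V) -> R, forall i : 'I_(size V), V`_i = F * w i.
  exact: (@fin_all_exists 'I_(size V) (fun=> R) (fun i w => V`_i = F * w)).
exists (\poly_(i < size V) (if insub i is Some j then w j else 0)).
apply/polyP => i; rewrite coefCM coef_poly.
case: ltnP => [lt_i|le_i]; last by rewrite nth_default // mulr0.
by rewrite insubT -Dw.
Qed.

End GenericCombination.

Lemma fraction_numden (D : idomainType) (x : {fraction D}) :
  exists n d, d != 0 /\ tofrac d * x = tofrac n.
Proof.
elim/quotW: x => x; exists \n_x, \d_x; split; first exact: denom_ratioP.
rewrite !piE; apply/eqmodP; rewrite /= FracField.equivfE /=.
by rewrite !numden_Ratio ?mul1r ?mulr1 ?oner_neq0 ?denom_ratioP // mulrC.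
Qed.

(** * Polynomials over K(t) *)

Section BaseChange.
Variable K : fieldType.
Let L := {fraction {poly K}}.
Let R := {mpoly K[3]}.

Definition ratfunC : {rmorphism K -> L} := @tofrac {poly K} \o polyC.
Definition genX : L := tofrac 'X.

Lemma ratfunC_eq0 c : (ratfunC c == 0) = (c == 0).
Proof. by rewrite /= tofrac_eq0 polyC_eq0. Qed.

Lemma ratfunC_inj : injective ratfunC.
Proof. by move=> c d /eqP; rewrite /= tofrac_eq => /eqP/polyC_inj. Qed.

Lemma genX_free N (c : nat -> K) : \sum_(i < N) ratfunC (c i) * genX ^+ i = 0 ->
  forall i, (i < N)%N -> c i = 0.
Proof.
move=> e i lt_i; have : \poly_(i < N) c i = 0.
  apply/eqP; rewrite -tofrac_eq0 poly_def rmorph_sum; apply/eqP; rewrite -[RHS]e.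
  by apply: eq_bigr => j _; rewrite -mul_polyC rmorphM rmorphXn.
by move/(congr1 (fun p : {poly K} => p`_i)); rewrite coef0 coef_poly lt_i.
Qed.

(* The indeterminate of P is evaluated at the generator of K(t). *)
Definition extend (P : {poly R}) : {mpoly L[3]} :=
  (map_poly (map_mpoly ratfunC) P).[genX%:MP].

HB.instance Definition _ := GRing.isZmodMorphism.Build {poly R} {mpoly L[3]} extend
  (raddfB (horner_eval genX%:MP \o map_poly (map_mpoly ratfunC))).
HB.instance Definition _ := GRing.isMonoidMorphism.Build {poly R} {mpoly L[3]} extend
  (rmorphism_monoidP (horner_eval genX%:MP \o map_poly (map_mpoly ratfunC))).
#[global] Arguments extend : simpl never.

Lemma extendE P :
  extend P = \sum_(i < size P) genX ^+ i *: map_mpoly ratfunC P`_i.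
Proof.
rewrite /extend (@horner_coef_wide _ (size P)) ?size_poly //.
by apply: eq_bigr => i _; rewrite coef_map -mul_mpolyC rmorphXn /= mulrC.
Qed.

Lemma extendC (f : R) : extend f%:P = map_mpoly ratfunC f.
Proof. by rewrite /extend map_polyC hornerC. Qed.

Lemma extendX : extend 'X = genX%:MP.
Proof. by rewrite /extend map_polyX hornerX. Qed.

Lemma extend_scalar (d : {poly K}) :
  extend (map_poly (@mpolyC 3 K) d) = (tofrac d)%:MP.
Proof.
elim/poly_ind: d => [|d c IH]; first by rewrite !rmorph0.
rewrite !rmorphD !rmorphM /= map_polyX extendX map_polyC extendC IH /= map_mpolyC.
by rewrite -rmorphM.
Qed.

Lemma extend_inj : injective extend.
Proof.
move=> P Q /eqP; rewrite -subr_eq0 -rmorphB => /eqP e; apply/eqP; rewrite -subr_eq0.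
move: (P - Q) e => {P Q} P e; apply/eqP/polyP => i; rewrite coef0.
have [lt_i|] := ltnP i (size P); last by move=> ge_i; rewrite nth_default.
apply/mpolyP => M; rewrite mcoeff0.
apply: (genX_free (c := fun i => P`_i@_M) _ lt_i).
rewrite -[RHS](mcoeff0 _ M) -e /= extendE (raddf_sum (mcoeff M)); apply: eq_bigr => j _ /=.
by rewrite mcoeffZ mcoeff_map_mpoly mulrC.
Qed.

Lemma extend_denominator (f : {mpoly L[3]}) :
  exists d P, d != 0 /\ (tofrac d)%:MP * f = extend P.
Proof.
elim/mpolyind: f => [|c M f _ _ [d [P [d0 DP]]]].
  by exists 1, 0; rewrite oner_neq0 mulr0 rmorph0.
have [a [b [b0 Da]]] := fraction_numden c.
exists (b * d), (map_poly (@mpolyC 3 K) d * map_poly (@mpolyC 3 K) a * ('X_[M])%:P +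
  map_poly (@mpolyC 3 K) b * P).
split; first by rewrite mulf_neq0.
rewrite rmorphD !rmorphM /= !extend_scalar extendC map_mpolyX -DP -Da.
by rewrite -mul_mpolyC !rmorphM /=; ring.
Qed.

Lemma chg_ratfunC (B : 'M[K]_3) f :
  chg (map_mx ratfunC B) (map_mpoly ratfunC f) = map_mpoly ratfunC (chg B f).
Proof.
apply: (mpoly_rmorph_eq (phi := chg (map_mx ratfunC B) \o map_mpoly ratfunC)
                        (psi := map_mpoly ratfunC \o chg B)) => [c|j] /=.
  by rewrite !map_mpolyC !chgC map_mpolyC.
rewrite map_mpolyX !chgX (raddf_sum (map_mpoly ratfunC)); apply: eq_bigr => i _.
by rewrite /= map_mpolyZ map_mpolyX mxE.
Qed.

Lemma van_ratfunC B r f : van B r f -> van (map_mx ratfunC B) r (map_mpoly ratfunC f).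
Proof.
by move=> vf M lt_M; rewrite chg_ratfunC mcoeff_map_mpoly vf ?rmorph0.
Qed.

Lemma van_extend B r P : van (map_mx ratfunC B) r (extend P) -> forall i, van B r P`_i.
Proof.
move=> vP i M lt_M.
have [lt_i|] := ltnP i (size P); last by move=> ge_i; rewrite nth_default // rmorph0 mcoeff0.
apply: (genX_free (c := fun i => (chg B P`_i)@_M) _ lt_i).
rewrite -[RHS](vP M lt_M) extendE (raddf_sum (chg _)) (raddf_sum (mcoeff M)).
apply: eq_bigr => j _ /=.
by rewrite linearZ /= chg_ratfunC mcoeffZ mcoeff_map_mpoly mulrC.
Qed.

Lemma dhomog_ratfunC d (f : {mpoly K[3]}) : f \is d.-homog -> map_mpoly ratfunC f \is d.-homog.
Proof.
move=> /dhomogP hf; apply/dhomogP => M.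
by rewrite (perm_mem (msupp_map_mpoly f ratfunC_inj)); apply: hf.
Qed.

Lemma meval_ratfunC (v : 'I_3 -> K) (f : {mpoly K[3]}) :
  (map_mpoly ratfunC f).@[fun j => ratfunC (v j)] = ratfunC f.@[v].
Proof.
apply: (mpoly_rmorph_eq (phi := meval (fun j => ratfunC (v j)) \o map_mpoly ratfunC)
                        (psi := ratfunC \o meval v)) => [c|j].
  by rewrite /= map_mpolyC !mevalC.
by rewrite [LHS]/= map_mpolyX /= !mevalXU.
Qed.

Lemma map_mpoly_ratfunC_eq0 (f : {mpoly K[3]}) : (map_mpoly ratfunC f == 0) = (f == 0).
Proof.
apply/eqP/eqP => [|->]; last by rewrite rmorph0.
by rewrite -extendC -(rmorph0 extend) => /extend_inj/polyC_inj.
Qed.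

(** Clearing the denominators of [u] and [v] gives a relation over R[t], where [regpair_generic]
    applies; the scalars are inverted at the end. *)
Lemma regpair_extend F g1 g2 : F != 0 -> g1 != 0 -> regpair g1 g2 ->
  regpair (map_mpoly ratfunC F) (extend (g1%:P + g2%:P * 'X)).
Proof.
move=> F0 g0 rg u v.
have [d [U [d0 DU]]] := extend_denominator u.
have [e [V [e0 DV]]] := extend_denominator v => E.
have scale_eq (S : comNzRingType) (p q x y a b : S) :
    p * a = q * b -> p * (x * a * y) = q * (y * b * x).
  by move=> E'; transitivity (x * y * (p * a)); [ring | rewrite E'; ring].
pose s := map_poly (@mpolyC 3 K).
have E' : F%:P * (U * s e) = (g1%:P + g2%:P * 'X) * (V * s d).
  apply: extend_inj; rewrite 2!rmorphM [RHS]rmorphM [in RHS]rmorphM /=.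
  by rewrite extendC !extend_scalar -DU -DV; apply: scale_eq.
have [W DW] := regpair_generic F0 g0 rg E'.
exists ((tofrac d * tofrac e)^-1 *: extend W).
have ed0 : tofrac d * tofrac e != 0 by rewrite mulf_neq0 ?tofrac_eq0.
have := congr1 extend DW; rewrite !rmorphM /= extendC extend_scalar -DV => EW.
rewrite -scalerAr -EW.
by rewrite mulrAC -mpolyCM mul_mpolyC scalerA [tofrac e * _]mulrC mulVf // scale1r.
Qed.

Section Descent.
Variable J : R -> Prop.
Hypothesis idJ : is_ideal J.

(** The extension of [J] to polynomials over K(t), expressed with denominators cleared. *)
Definition spanned (h : {mpoly L[3]}) := exists d P,
  [/\ d != 0, (tofrac d)%:MP * h = extend P & forall i, J P`_i].

Lemma spannedD g h : spanned g -> spanned h -> spanned (g + h).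
Proof.
case: idJ => J0 JD JM [d [P [d0 DP JP]]] [e [Q [e0 DQ JQ]]].
pose s := map_poly (@mpolyC 3 K).
have Js (c : {poly K}) (S : {poly R}) : (forall i, J S`_i) -> forall i, J (s c * S)`_i.
  by move=> JS i; rewrite coefM; apply: big_ind => // j _; apply: JM.
exists (d * e), (s e * P + s d * Q); split; first by rewrite mulf_neq0.
  by rewrite rmorphD !rmorphM /= !extend_scalar -DP -DQ; ring.
by move=> i; rewrite coefD; apply: JD; apply: Js.
Qed.

(** Here [P] is [d] times [f], so its coefficient in the degree of [d] is a nonzero constant times
    [f]. *)
Lemma spanned_ratfunC f : spanned (map_mpoly ratfunC f) -> J f.
Proof.
case: idJ => J0 JD JM [d [P [d0 DP JP]]].
have DP' : P = map_poly (@mpolyC 3 K) d * f%:P.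
  by apply: extend_inj; rewrite rmorphM /= extendC extend_scalar DP.
have := JM (lead_coef d)^-1%:MP _ (JP (size d).-1).
rewrite DP' coefMC coef_map mulrA -rmorphM /= -lead_coefE mulVf ?lead_coef_eq0 //.
by rewrite mpolyC1 mul1r.
Qed.

End Descent.

Lemma vanish_ratfunC_descent n (A : 'I_n -> 'M[K]_3) m h :
  vanish (fun i => map_mx ratfunC (A i)) m h -> spanned (vanish A m) h.
Proof.
move=> vh; have [d [P [d0 DP]]] := extend_denominator h.
exists d, P; split=> // j i; apply: van_extend; rewrite -DP.
exact: vanMl.
Qed.

(** In each summand the coefficient is spanned by I(m), and [F] and g1 + t g2 have their
    coefficients in I(m), which makes [k.+1] factors from I(m); [spanned_ratfunC] then descends to
    K. *)
Lemma pencil_descent n (A : 'I_n -> 'M[K]_3) m F g1 g2 k f :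
  vanish A m F -> vanish A m g1 -> vanish A m g2 ->
  pencil (map_mpoly ratfunC F) (extend (g1%:P + g2%:P * 'X))
    (vanish (fun i => map_mx ratfunC (A i)) m) k (map_mpoly ratfunC f) ->
  ideal_pow (vanish A m) k.+1 f.
Proof.
move=> vF v1 v2 [c vc Dc]; have idJ := ideal_pow_ideal (vanish A m) k.+1.
have vD u v : vanish A m u -> vanish A m v -> vanish A m (u + v).
  by move=> vu vv i; apply: vanD.
have vM u v : vanish A m v -> vanish A m (u * v) by move=> vv i; apply: vanMl.
have v0 : vanish A m 0 by move=> i; apply: van_zero.
have vC h : vanish A m h -> forall l, vanish A m (h%:P)`_l.
  by move=> vh l; rewrite coefC; case: ifP.
have vG l : vanish A m (g1%:P + g2%:P * 'X)`_l.
  by rewrite coefD; apply: vD; [apply: vC | rewrite coefMX; case: ifP => // _; apply: vC].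
apply: (spanned_ratfunC idJ); rewrite Dc; apply: big_ind => [||i _].
- case: idJ => I0 _ _; exists 1, 0; rewrite oner_neq0 mulr0 rmorph0.
  by split=> // i; rewrite coef0.
- exact: spannedD.
have [d [P [d0 DP vP]]] := vanish_ratfunC_descent (vc i).
exists d, (P * (F%:P ^+ i * (g1%:P + g2%:P * 'X) ^+ (k - i))).
split; first exact: d0.
  by rewrite [LHS]mulrA DP !rmorphM !rmorphXn /= extendC.
apply: coef_idealM => // l.
have vFX := @coef_idealX _ _ _ _ i (k - i) (vC _ vF) _ l; rewrite subnKC ?leq_ord // in vFX.
apply: vFX => j; have := @coef_idealX _ _ _ 1 (k - i) 0 vG _ j.
by rewrite addn0 mulr1; apply.
Qed.

End BaseChange.

(** * Powers of the ideal of a point *)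

Section PointIdeals.
Variable K : fieldType.
Implicit Types (A B C : 'M[K]_3) (f g : {mpoly K[3]}).

Lemma van_ideal A r : is_ideal (van A r).
Proof. by split; [apply: van_zero | apply: vanD | apply: vanMl]. Qed.

Lemma ideal_pow_vanish n (A : 'I_n -> 'M[K]_3) m k f :
  ideal_pow (vanish A m) k f -> vanish A (m * k) f.
Proof.
move=> pf i; elim: k f pf => [|k IH] f; first by rewrite muln0.
apply: (ideal_gen_sub (van_ideal _ _)) => h [u [v [vu pv ->]]].
by rewrite mulnS; apply: vanM; [apply: vu | apply: IH].
Qed.

(** In the coordinates given by [A], the ideal of the point is generated by the last two variables,
    so its [r]-th power is spanned by the monomials of degree at least [r] in these two. *)
Lemma point_ideal_powE A (u : 'rV[K]_3) r f : A \in unitmx -> A i0 =1 u 0 ->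
  ideal_pow (point_ideal u) r f <-> van A r f.
Proof.
move=> uA Au; split=> [|vf].
  elim: r f => [//|r IH] f; apply: (ideal_gen_sub (van_ideal _ _)) => h [v [w [pv pw ->]]].
  rewrite -add1n; apply: vanM; last exact: IH.
  apply: (ideal_gen_sub (van_ideal _ _)) pv => l [[d hl] l0].
  by apply: van1 hl _; rewrite -l0; apply: meval_eq.
have [I0 ID IM] := ideal_pow_ideal (point_ideal u) r.
rewrite -[f](chgK uA) [chg A f]mpolyE (raddf_sum (chg _)) big_seq.
apply: big_ind => // M; rewrite mcoeff_msupp /= => fM; rewrite linearZ /= -mul_mpolyC; apply: (IM).
have le_rM : (r <= M i1 + M i2)%N by rewrite leqNgt; apply: contraNN fM => /vf->.
rewrite mpolyXE_id rmorph_prod big_ord3 /= !rmorphXn /=; apply: (IM).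
apply: ideal_powW le_rM _.
have Jy k : k != i0 -> point_ideal u (chg (invmx A) 'X_k).
  move=> k0; apply: sub_ideal_gen; split; first by exists 1%N; apply/dhomog_chg/dhomogXU.
  rewrite -(meval_eq _ Au) eval_chg0 chgVK // mevalXU.
  by rewrite (negbTE k0).
have p2 := @mem_ideal_powX _ _ (M i2) 0 _ 1 (Jy i2 isT) I.
by have := @mem_ideal_powX _ _ (M i1) _ _ _ (Jy i1 isT) p2; rewrite addn0 mulr1.
Qed.

End PointIdeals.

(** * Regular sequences of length two *)

Section RegularSequences.
Variable R : idomainType.
Implicit Types f g h : R.

Lemma ideal_gen0 h : ideal_gen (fun f : R => f \in [::]) h <-> h = 0.
Proof.
split=> [|->]; last by case: (ideal_gen_ideal (fun f : R => f \in [::])).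
apply: (ideal_gen_sub (J := fun h => h = 0)) => //; split=> // [f g -> ->|f g ->].
  by rewrite addr0.
by rewrite mulr0.
Qed.

Lemma ideal_gen1 f h : ideal_gen (fun f' : R => f' \in [:: f]) h <-> exists w, h = f * w.
Proof.
split=> [|[w ->]]; last first.
  have [_ _ IM] := ideal_gen_ideal (fun f' : R => f' \in [:: f]).
  by rewrite mulrC; apply: IM; apply: sub_ideal_gen; rewrite mem_head.
apply: (ideal_gen_sub (J := fun h => exists w, h = f * w)); last first.
  by move=> g; rewrite inE => /eqP->; exists 1; rewrite mulr1.
split=> [|u v [a ->] [b ->]|u v [a ->]]; first by exists 0; rewrite mulr0.
  by exists (a + b); rewrite mulrDr.
by exists (u * a); rewrite mulrCA.
Qed.

Lemma regular_sequence2 f g : regular_sequence [:: f; g] ->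
  [/\ f != 0, regpair f g & g != 0].
Proof.
case=> reg prop.
have f0 : f != 0.
  apply/eqP => f0; have /(_ 1) := reg 0%N isT.
  by rewrite /= !ideal_gen0 f0 mul0r => /(_ erefl)/eqP; rewrite oner_eq0.
have rfg : regpair f g.
  move=> u v e; have /(_ v) := reg 1%N isT; rewrite /= !ideal_gen1.
  by apply; exists u.
(* For g = 0, regularity would make 1 a multiple of [f], against properness. *)
split=> //; apply/eqP => g0; have [|w e] := rfg 0 1; first by rewrite g0 mulr0 mul0r.
case: prop; rewrite g0.
have [_ _ IM] := ideal_gen_ideal (fun f' : R => f' \in [:: f; 0]).
by rewrite e mulrC; apply: IM; apply: sub_ideal_gen; rewrite mem_head.
Qed.

Lemma regular_sequenceP f g : f != 0 -> regpair f g ->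
  ~ ideal_gen (fun h : R => h \in [:: f; g]) 1 -> regular_sequence [:: f; g].
Proof.
move=> f0 rfg prop; split=> // -[|[|//]] _ h /=.
  by rewrite !ideal_gen0 => /eqP; rewrite mulf_eq0 (negbTE f0) => /eqP.
by rewrite !ideal_gen1 => -[u e]; apply: (rfg u); rewrite e.
Qed.

End RegularSequences.

(** * Coordinates adapted to the points *)

Section Charts.
Variable K : fieldType.

Lemma exists_chart (u : 'rV[K]_3) : u != 0 -> exists A : 'M[K]_3, A \in unitmx /\ A i0 =1 u 0.
Proof.
move=> u0; pose B : 'M[K]_3 := \matrix_(i, j) u 0 j; pose e : 'rV[K]_3 := delta_mx 0 i0.
have eB : e *m B = u by rewrite -rowE; apply/rowP => j; rewrite !mxE.
have e0 : e != 0.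
  by apply/eqP => /rowP/(_ i0); rewrite !mxE !eqxx => /eqP; rewrite oner_eq0.
have [|A uA eA] := @complete_unitmx _ _ _ e B; first by rewrite eB !rank_rV u0 e0.
exists A; split=> // j; have /rowP/(_ j) : u = row i0 A by rewrite rowE -eA.
by rewrite mxE => ->.
Qed.

(** If both local coordinates of the chart at point [j] vanish at point [i], the two points
    coincide; so one of these coordinates serves as the line. *)
Lemma separating_line n (p : 'I_n -> 'rV[K]_3) (A : 'I_n -> 'M[K]_3) :
  (forall i, A i \in unitmx) -> (forall i, A i i0 =1 p i 0) ->
  (forall i, p i != 0) -> (forall i j, i != j -> ~ same_point (p i) (p j)) ->
  forall i j, i != j -> exists l : {mpoly K[3]},
    [/\ l \is 1.-homog, l.@[A j i0] = 0 & l.@[A i i0] != 0].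
Proof.
move=> uA Ap p0 neq_p i j ne_ij.
have ev k : (chg (invmx (A j)) 'X_k).@[A i i0] = (p i *m invmx (A j)) 0 k.
  rewrite chgX raddf_sum mxE; apply: eq_bigr => l _.
  by rewrite /= mevalZ mevalXU Ap mulrC.
have ev0 k : (chg (invmx (A j)) 'X_k).@[A j i0] = (k == i0)%:R.
  by rewrite eval_chg0 chgVK // mevalXU.
have hom k : chg (invmx (A j)) 'X_k \is 1.-homog by apply/dhomog_chg/dhomogXU.
pose c := p i *m invmx (A j).
have [c1|c1] := eqVneq (c 0 i1) 0; last first.
  by exists (chg (invmx (A j)) 'X_i1); split; rewrite ?ev ?ev0.
have [c2|c2] := eqVneq (c 0 i2) 0; last first.
  by exists (chg (invmx (A j)) 'X_i2); split; rewrite ?ev ?ev0.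
have Dp : p i = c 0 i0 *: p j.
  rewrite -[p i](mulmxKV (uA j)) -/c; apply/rowP => k.
  by rewrite mxE big_ord3 /= c1 c2 !mul0r !addr0 Ap [RHS]mxE.
have [c0|c0] := eqVneq (c 0 i0) 0; last first.
  case: (neq_p j i); first by rewrite eq_sym.
  by exists (c 0 i0).
by case/eqP: (p0 i); rewrite Dp c0 scale0r.
Qed.

End Charts.

(** * Regular pairs of lines and conics *)

Section RegularPairExists.
Variable K : fieldType.
Implicit Types (A B C : 'M[K]_3).

(** Smooth in every characteristic, and passing through (1, 0, 0). *)
Definition conic : {mpoly K[3]} := 'X_i0 * 'X_i1 + 'X_i2 * 'X_i2.

Lemma conic_rmorph (S : comNzRingType) (phi : {rmorphism {mpoly K[3]} -> S}) :
  phi conic = phi 'X_i0 * phi 'X_i1 + phi 'X_i2 * phi 'X_i2.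
Proof. by rewrite rmorphD 2!rmorphM. Qed.

Lemma quadric_coefs (a b c : K) :
  a%:MP * ('X_i0 * 'X_i0) + b%:MP * ('X_i0 * 'X_i2) + c%:MP * ('X_i2 * 'X_i2) = 0
    :> {mpoly K[3]} ->
  [/\ a = 0, b = 0 & c = 0].
Proof.
rewrite -!mpolyXD !mul_mpolyC => e.
have ne (M N : 'X_{1..3}) : M i0 != N i0 -> (M == N) = false.
  by move=> h; apply/negbTE; apply: contraNneq h => ->.
pose co M := congr1 (mcoeff M) e.
split; [move: (co (U_(i0) + U_(i0))%MM) | move: (co (U_(i0) + U_(i2))%MM)
  | move: (co (U_(i2) + U_(i2))%MM)];
  by rewrite mcoeff0 !mcoeffD !mcoeffZ !mcoeffX eqxx !ne ?mnmDE ?mnm1E //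
    !mulr0 ?mulr1 ?addr0 ?add0r.
Qed.

(** The hypotheses say that [x] and [y] span an isotropic subspace for the quadratic form [conic].
    In every characteristic, the square of each minor is a combination of the three expressions
    assumed zero. *)
Lemma isotropic_minors (x0 x1 x2 y0 y1 y2 : K) :
  x0 * x1 + x2 * x2 = 0 -> x0 * y1 + y0 * x1 + (x2 * y2 + y2 * x2) = 0 ->
  y0 * y1 + y2 * y2 = 0 ->
  [/\ x0 * y1 = x1 * y0, x0 * y2 = x2 * y0 & x1 * y2 = x2 * y1].
Proof.
move=> e0 e1 e2.
split; apply/eqP; rewrite -subr_eq0 -sqrf_eq0.
- set E0 := x0 * x1 + _ in e0; set E1 := x0 * y1 + _ + _ in e1; set E2 := y0 * y1 + _ in e2.
  rewrite (_ : _ ^+ 2 = E1 * (E1 - 4%:R * (x2 * y2)) - 4%:R * E0 * E2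
    + 4%:R * E0 * (y2 * y2) + 4%:R * E2 * (x2 * x2)); last by rewrite /E0 /E1 /E2; ring.
  by rewrite e0 e1 e2 !(mul0r, mulr0, addr0, subr0).
- set E0 := x0 * x1 + _ in e0; set E1 := x0 * y1 + _ + _ in e1; set E2 := y0 * y1 + _ in e2.
  rewrite (_ : _ ^+ 2 = x0 * x0 * E2 - x0 * y0 * E1 + y0 * y0 * E0); last first.
    by rewrite /E0 /E1 /E2; ring.
  by rewrite e0 e1 e2 !(mul0r, mulr0, addr0, subr0).
set E0 := x0 * x1 + _ in e0; set E1 := x0 * y1 + _ + _ in e1; set E2 := y0 * y1 + _ in e2.
rewrite (_ : _ ^+ 2 = x1 * x1 * E2 - x1 * y1 * E1 + y1 * y1 * E0); last first.
  by rewrite /E0 /E1 /E2; ring.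
by rewrite e0 e1 e2 !(mul0r, mulr0, addr0, subr0).
Qed.

(* A smooth conic contains no line. *)
Lemma conic_line C : C \in unitmx -> killX (pred1 i1) (chg C conic) != 0.
Proof.
move=> uC; apply/eqP.
have z j : killX (pred1 i1) (chg C 'X_j) = (C i0 j)%:MP * 'X_i0 + (C i2 j)%:MP * 'X_i2.
  rewrite chgX (raddf_sum (killX _)) big_ord3 /= -!mul_mpolyC.
  rewrite 3!(rmorphM (killX _)) /= !killXU /= mulr0 add0r.
  by rewrite /killX 2!comp_mpolyC.
rewrite -[LHS]/((killX (pred1 i1) \o chg C) conic) conic_rmorph /= !z => e.
(* Rows 0 and 2 of [C] span the line; isotropy would make them proportional. *)
pose x j := C i0 j; pose y j := C i2 j.
have [e0 e1 e2] : [/\ x i0 * x i1 + x i2 * x i2 = 0,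
    x i0 * y i1 + y i0 * x i1 + (x i2 * y i2 + y i2 * x i2) = 0 &
    y i0 * y i1 + y i2 * y i2 = 0].
  by apply: quadric_coefs; rewrite -[RHS]e !mpolyCD !mpolyCM; ring.
have [m01 m02 m12] := isotropic_minors e0 e1 e2.
have dep j : y j *: row i0 C = x j *: row i2 C.
  apply/rowP; move: j; apply: ord3P; apply: ord3P; rewrite !mxE -/(x _) -/(y _);
    by rewrite ?(mulrC (y _)) ?m01 ?m02 ?m12 // mulrC.
have rows_free (c d : K) : c *: row i0 C = d *: row i2 C -> c = 0.
  move=> ecd; have : (c *: delta_mx 0 i0 - d *: delta_mx 0 i2 : 'rV_3) *m C = 0.
    by rewrite mulmxBl -!scalemxAl -!rowE ecd subrr.
  move/(congr1 (mulmx^~ (invmx C))); rewrite mulmxK // mul0mx => /rowP/(_ i0).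
  by rewrite !mxE /= mulr1 mulr0 subr0.
have y0 j : y j = 0 by apply: rows_free (dep j).
have row0 : row i2 C = 0 by apply/rowP => j; rewrite !mxE -/(y j) y0.
have := oner_neq0 K; apply/negP/negPn/eqP.
have : (delta_mx 0 i2 : 'rV[K]_3) *m C = 0 by rewrite -rowE.
move/(congr1 (mulmx^~ (invmx C))); rewrite mulmxK // mul0mx => /rowP/(_ i2).
by rewrite !mxE.
Qed.

(** In the coordinates of [A] the line is X1 = 0; modulo it the ring is a domain, where the conic
    stays nonzero by [conic_line]. *)
Lemma regpair_line_conic A B : A \in unitmx -> B \in unitmx ->
  regpair (chg (invmx A) 'X_i1) (chg (invmx B) conic).
Proof.
move=> uA uB u v /(congr1 (chg A)).
rewrite 2!(rmorphM (chg A)) /= chgVK // chg_comp => e.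
have uC : A *m invmx B \in unitmx by rewrite unitmx_mul uA unitmx_inv.
have kM f g : killX (pred1 i1) (f * g) = killX (pred1 i1) f * killX (pred1 i1) g.
  exact: rmorphM.
have := congr1 (killX (pred1 i1)) e; rewrite kM [RHS]kM killXU /= mul0r => e0.
have k0 : killX (pred1 i1) (chg A v) = 0.
  by apply: (mulfI (conic_line uC)); rewrite mulr0 -e0.
have [w Dv] := killXE (pred1 i1) (chg A v).
exists (chg (invmx A) (w i1)); rewrite -[v](chgK uA) -(rmorphM (chg _)) Dv k0.
by rewrite add0r big_pred1_eq.
Qed.

Lemma dhomog_prod_const (I : Type) (s : seq I) (F : I -> {mpoly K[3]}) d :
  (forall i, F i \is d.-homog) -> \prod_(i <- s) F i \is (d * size s).-homog.
Proof.
move=> hF; elim: s => [|i s IH]; first by rewrite big_nil muln0 dhomog1.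
by rewrite big_cons mulnS dhomogM.
Qed.

Lemma exists_regular_pair n (A : 'I_n -> 'M[K]_3) m : (forall i, A i \in unitmx) ->
  exists d f g, [/\ f \is d.-homog /\ g \is d.-homog, vanish A m f, vanish A m g,
    f != 0 & regpair f g].
Proof.
move=> uA; pose l i : {mpoly K[3]} := chg (invmx (A i)) 'X_i1.
pose q i := chg (invmx (A i)) conic.
have hl i : l i \is 1.-homog by apply/dhomog_chg/dhomogXU.
have hq i : q i \is 2.-homog.
  by apply: dhomog_chg; rewrite rpredD // (dhomogM (d := 1) (e := 1)) ?dhomogXU.
have l0 i : l i != 0.
  apply: contraNneq (mpolyX_neq0 K U_(i1)) => li.
  by rewrite -(chgVK (uA i) 'X_i1) -/(l i) li rmorph0.
(* The exponents [2 * m] on lines and [m] on conics give both products the same degree, as [beta]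
   requires. *)
exists (2 * m * size (index_enum 'I_n))%N, (\prod_i l i ^+ (2 * m)), (\prod_i q i ^+ m).
have vl i : van (A i) 1 (l i).
  by apply: van1 (hl i) _; rewrite eval_chg0 chgVK // mevalXU.
have vq i : van (A i) 1 (q i).
  apply: van1 (hq i) _; rewrite eval_chg0 chgVK //.
  by rewrite mevalD !mevalM !mevalXU mulr0 mul0r addr0.
split.
- split; apply: dhomog_prod_const => i; last exact: dhomogMn.
  by have := dhomogMn (2 * m) (hl i); rewrite mul1n.
- move=> i; rewrite (bigD1 i) //= mulrC; apply: vanMl.
  have vX := vanX (k := 2 * m) (vl i).
  by apply: van_mono vX; rewrite mul1n leq_pmull.
- move=> i; rewrite (bigD1 i) //= mulrC; apply: vanMl.
  by have := vanX (k := m) (vq i); rewrite mul1n.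
- by apply/prodf_neq0 => i _; rewrite expf_neq0.
apply: regpair_prodl => [i|i]; first by rewrite expf_neq0.
apply: regpairXl => //; apply: regpair_prodr => j; apply: regpairXr.
exact: regpair_line_conic.
Qed.

End RegularPairExists.

(** * The invariants alpha and beta *)

Section SymbolicPowers.
Variables (K : fieldType) (n : nat) (p : 'I_n -> 'rV[K]_3) (A : 'I_n -> 'M[K]_3).
Hypotheses (uA : forall i, A i \in unitmx) (Ap : forall i, A i i0 =1 p i 0).
Hypothesis sepA : forall i j, i != j ->
  exists l : {mpoly K[3]}, [/\ l \is 1.-homog, l.@[A j i0] = 0 & l.@[A i i0] != 0].

Lemma symbolic_powerE m f : symbolic_power p m f <-> vanish A m f.
Proof. by split=> h i; apply/(point_ideal_powE _ _ (uA i) (Ap i)). Qed.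

Lemma alpha_symbolicP m :
  is_least (fun l => exists2 f, component (symbolic_power p m) l f & f != 0)
    (alpha (symbolic_power p m)).
Proof.
apply: leastP; have [d [f [g [[hf _] vf _ f0 _]]]] := exists_regular_pair m uA.
by exists d, f => //; split=> //; apply/symbolic_powerE.
Qed.

(** Since [n] and [m] are positive, both members of the regular pair vanish at some point, so they
    generate a proper ideal. *)
Lemma beta_symbolicP m : (0 < n)%N -> (0 < m)%N ->
  is_least (fun l => exists f g, [/\ component (symbolic_power p m) l f,
      component (symbolic_power p m) l g & regular_sequence [:: f; g]])
    (beta (symbolic_power p m)).
Proof.
move=> n0 m0; apply: leastP.
have [d [f [g [[hf hg] vf vg f0 rfg]]]] := exists_regular_pair m uA.
exists d, f, g; split.
- by split=> //; apply/symbolic_powerE.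
- by split=> //; apply/symbolic_powerE.
apply: regular_sequenceP => // fg1; pose i := Ordinal n0.
have : (1 : {mpoly K[3]}).@[A i i0] = 0.
  apply: (ideal_gen_sub (J := fun h => h.@[A i i0] = 0)) fg1.
    split=> [|u v u0 v0|u v v0]; first exact: meval0.
      by rewrite mevalD u0 v0 addr0.
    by rewrite mevalM v0 mulr0.
  by move=> h; rewrite !inE => /orP[] /eqP->; apply: van_eval m0 _; [apply: vf | apply: vg].
by rewrite meval1 => /eqP; rewrite oner_eq0.
Qed.

(** No nonzero form of degree one less than alpha vanishes at all the points, so [n] is at least the
    dimension of the space of forms of that degree. *)
Lemma alpha1_bound :
  ((alpha (symbolic_power p 1)).+1 * alpha (symbolic_power p 1) <= 2 * n)%N.
Proof.
have [_] := alpha_symbolicP 1; case: alpha => [|d] // min.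
have := dim_vansp_ge A 1 d; rewrite binn muln1.
suff -> : vansp A 1 d = 0%VS by rewrite dimv0 -mul2_binS leq_mul2l.
apply/eqP; rewrite -subv0; apply/subvP => f /mem_vansp vf; rewrite memv0.
apply: contraT => f0; have /min : exists2 h, component (symbolic_power p 1) d h & h != 0.
  exists (val f) => //; split; first exact/symbolic_powerE.
  exact: dhomog_is_dhomog.
by rewrite ltnn.
Qed.

Let L := {fraction {poly K}}.
Let A' i := map_mx (ratfunC K) (A i).

(** [F] may share a factor with [g1] or with [g2], but it forms a regular pair with their generic
    combination, which keeps the degree beta. *)
Lemma generic_pair m : (0 < n)%N -> (0 < m)%N ->
  exists F g1 g2, [/\ vanish A m F, vanish A m g1 & vanish A m g2] /\
    let F' := map_mpoly (ratfunC K) F in let G' := extend (g1%:P + g2%:P * 'X) in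
    [/\ F' \is (alpha (symbolic_power p m)).-homog /\
          G' \is (beta (symbolic_power p m)).-homog,
        vanish A' m F', vanish A' m G', F' != 0 /\ G' != 0 & regpair F' G'].
Proof.
move=> n0 m0.
have [[F [/symbolic_powerE vF hF] F0] _] := alpha_symbolicP m.
have [[g1 [g2 [[/symbolic_powerE v1 h1] [/symbolic_powerE v2 h2] reg]]] _] :=
  beta_symbolicP n0 m0.
have [g10 r12 _] := regular_sequence2 reg.
exists F, g1, g2; split; first by split.
have DG : extend (g1%:P + g2%:P * 'X) =
    map_mpoly (ratfunC K) g1 + genX K *: map_mpoly (ratfunC K) g2.
  by rewrite rmorphD rmorphM /= !extendC extendX mulrC mul_mpolyC.
split.
- split; first exact: dhomog_ratfunC.
  by rewrite DG rpredD ?rpredZ // dhomog_ratfunC.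
- by move=> i; apply: van_ratfunC.
- move=> i; rewrite DG -mul_mpolyC; apply: vanD; first exact: van_ratfunC.
  by apply: vanMl; apply: van_ratfunC.
- split; first by rewrite map_mpoly_ratfunC_eq0.
  rewrite -(rmorph0 (@extend K)) (inj_eq (@extend_inj K)).
  by apply: contraNneq g10 => /polyC_addX_eq0 ->.
exact: regpair_extend.
Qed.

Lemma uA' i : A' i \in unitmx.
Proof. by rewrite map_unitmx. Qed.

Lemma sepA' i j : i != j ->
  exists l : {mpoly L[3]}, [/\ l \is 1.-homog, l.@[A' j i0] = 0 & l.@[A' i i0] != 0].
Proof.
move/sepA => [l [hl l0 l1]]; exists (map_mpoly (ratfunC K) l).
have ev k : (map_mpoly (ratfunC K) l).@[A' k i0] = ratfunC K l.@[A k i0].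
  by rewrite -meval_ratfunC; apply: meval_eq => c; rewrite mxE.
by rewrite !ev ratfunC_eq0 l0 rmorph0; split=> //; apply: dhomog_ratfunC.
Qed.

Lemma alpha_beta_ge m : (0 < n)%N -> (0 < m)%N ->
  (m ^ 2 * n <= alpha (symbolic_power p m) * beta (symbolic_power p m))%N.
Proof.
move=> n0 m0; have [F [g1 [g2 [_ [[hF hG] vF vG [F0 G0] FG]]]]] := generic_pair n0 m0.
exact: (bezout_vanish uA' sepA' hF hG vF vG F0 FG G0).
Qed.

(** Orders of vanishing add, which gives one inclusion; the other is [pencil_vanish] over K(t),
    brought down to K by [pencil_descent]. *)
Lemma symbolic_power_eq m k f : (0 < n)%N -> (0 < m)%N ->
  (alpha (symbolic_power p m) * beta (symbolic_power p m) = m ^ 2 * n)%N ->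
  ideal_pow (symbolic_power p m) k.+1 f <-> symbolic_power p (m * k.+1) f.
Proof.
move=> n0 m0 eq_ab; split=> [pf|/symbolic_powerE vf].
  apply/symbolic_powerE/ideal_pow_vanish; apply: ideal_pow_sub pf => g.
  by move/symbolic_powerE.
have [F [g1 [g2 [[v vg1 vg2] [[hF hG] vF vG [F0 G0] FG]]]]] := generic_pair n0 m0.
apply: (@ideal_pow_sub _ (vanish A m)) => [g|]; first by move/symbolic_powerE.
apply: (pencil_descent v vg1 vg2).
apply: (pencil_vanish uA' sepA' hF hG vF vG F0 FG G0 eq_ab).
by move=> i; apply: van_ratfunC.
Qed.

End SymbolicPowers.

Theorem proposition3p5 (K : fieldType) (n : nat) (p : 'I_n -> 'rV[K]_3)
  (n_gt0 : (0 < n)%N)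
  (p_neq0 : forall i, p i != 0)
  (p_distinct : forall i j, i != j -> ~ same_point (p i) (p j))
  (m : nat) (m_gt0 : (0 < m)%N) :
  let a (k : nat) := alpha (symbolic_power p k) in
  let b (k : nat) := beta (symbolic_power p k) in
  [/\ (m ^ 2 * n <= a m * b m)%N,
      ((a 1%N)%:R + 1) / 2%:R * (m%:R * (a 1%N)%:R / (b m)%:R)
        <= (a m)%:R / m%:R :> rat
    & (a m * b m = m ^ 2 * n)%N ->
      forall k : nat, (0 < k)%N -> forall f : {mpoly K[3]},
        ideal_pow (symbolic_power p m) k f <-> symbolic_power p (m * k) f].
Proof.
move=> a b.
have [A uAp] := fin_all_exists (fun i => exists_chart (p_neq0 i)).
have uA i : A i \in unitmx by case: (uAp i).
have Ap i : A i i0 =1 p i 0 by case: (uAp i).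
have sepA := separating_line uA Ap p_neq0 p_distinct.
have ab_ge := alpha_beta_ge uA Ap sepA n_gt0 m_gt0.
split=> //; last first.
  by move=> eq_ab [//|k] _ f; apply: (symbolic_power_eq uA Ap sepA).
have a1 := alpha1_bound uA Ap.
rewrite -/(a m) -/(b m) -/(a 1%N) in ab_ge a1 *.
(* Division by zero yields 0, so for [b m = 0] the left side is 0. *)
have [b0|b_gt0] := posnP (b m).
  by rewrite b0 invr0 !mulr0 divr_ge0 ?ler0n.
have m0 : 0 < m%:R :> rat by rewrite ltr0n.
have b1 : 0 < (b m)%:R * 2%:R :> rat by rewrite mulr_gt0 ?ltr0n.
rewrite ler_pdivlMr //.
(* Cleared of denominators, the inequality combines alpha_1 (alpha_1 + 1) <= 2 n with m^2 n <=
   alpha_m beta_m. *)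
rewrite (_ : _ * m%:R = (m ^ 2 * ((a 1%N).+1 * a 1%N))%:R / ((b m)%:R * 2%:R)); last first.
  rewrite -mulnn !natrM -natr1; field; by rewrite pnatr_eq0 -lt0n.
rewrite ler_pdivrMr // -!natrM ler_nat.
apply: leq_trans (leq_mul (leqnn _) a1) _.
by rewrite mulnCA [leqRHS]mulnA [leqRHS]mulnC leq_mul2l.
Qed.
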